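(* Let $p\in(0,1)$, $s,t\ge0$, $u\in(p,1)$ and $\xi\ge0$. (a) The limit $\Lambda^{(u),\mathrm{hor}}_{(s,t)}(\xi)=\lim_{N\to\infty}N^{-1}\log\mathbb E\,e^{\xi G^{(u),\mathrm{hor}}_{\lfloor Ns\rfloor,\lfloor Nt\rfloor}}$ exists and is given by $$\Lambda^{(u),\mathrm{hor}}_{(s,t)}(\xi)=\begin{cases}s\,C_{\mathcal B}^{(u)}(\xi)-t\,C_{\mathcal G}^{\left(\frac{u-p}{u(1-p)}\right)}(-\xi), & \text{if }t<k^{(u)}(\xi)s,\\ \Lambda_{(s,t)}(\xi), & \text{if }t\ge k^{(u)}(\xi)s.\end{cases}$$ (b) The limit $\Lambda^{(u),\mathrm{ver}}_{(s,t)}(\xi)=\lim_{N\to\infty}N^{-1}\log\mathbb E\,e^{\xi G^{(u),\mathrm{ver}}_{\lfloor Ns\rfloor,\lfloor Nt\rfloor}}$ exists and is given by $$\Lambda^{(u),\mathrm{ver}}_{(s,t)}(\xi)=\begin{cases}t\,C_{\mathcal G}^{\left(\frac{u-p}{u(1-p)}\right)}(\xi)-s\,C_{\mathcal B}^{(u)}(-\xi), & \text{if }\xi\in\big[0,\log\tfrac{u(1-p)}{p(1-u)}\big)\text{ and }t>k^{(u)}(-\xi)s,\\ \Lambda_{(s,t)}(\xi), & \text{if }\xi\in\big[0,\log\tfrac{u(1-p)}{p(1-u)}\big)\text{ and }t\le k^{(u)}(-\xi)s,\\ \infty, & \text{if }\xi\in\big[\log\tfrac{u(1-p)}{p(1-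u)},\infty\big).\end{cases}$$
   Context: Let $\mathbb N=\{1,2,\dots\}$, $\mathbb Z_+=\{0,1,2,\dots\}$. The environment $\{\omega_v\}_{v\in\mathbb Z_+^2}$ consists of independent variables: $\omega_{i,j}\sim$ Bernoulli($p$) for $(i,j)\in\mathbb N^2$; $\omega_{i,0}\sim$ Bernoulli($u$) for $i\in\mathbb N$; $\omega_{0,j}\sim$ Geometric$\big(\frac{u-p}{u(1-p)}\big)$ for $j\in\mathbb N$, i.e. $\mathbb P\{\omega_{0,j}=\ell\}=\frac{u-p}{u(1-p)}\big(\frac{p(1-u)}{u(1-p)}\big)^{\ell}$, $\ell\in\mathbb Z_+$; and $\omega_{0,0}=0$. $G_{v,w}=\max_\pi\sum_i\omega_{v_{i+1}}\mathbf 1\{v_{i+1}-v_i=e_1\}$ is the last passage time from $v$ to $w$, the maximum being over paths $v=v_0,\dots,v_k=w$ with $v_{i+1}-v_i\in\{e_1,e_2\}$. The passage times with boundary, according to whether the first step is horizontal or vertical, are $$G^{(u),\mathrm{hor}}_{\lfloor Ns\rfloor,\lfloor Nt\rfloor}=\max_{1\le k\le \lfloor Ns\rfloor}\Big\{\sum_{i=1}^k\omega_{i,0}+G_{(k,1),(\lfloor Ns\rfloor,\lfloor Nt\rfloor)}\Big\},$$ $$G^{(u),\mathrm{ver}}_{\lfloor Ns\rfloor,\lfloor Nt\rfloor}=\max_{1\le \ell\le \lfloor Nt\rfloor}\Big\{\sum_{j=1}^\ell\omega_{0,j}+\omega_{1,\ell}+G_{(1,\ell),(\lfloor Ns\rfloor,\lfloor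 Nt\rfloor)}\Big\}.$$ $C_{\mathcal B}^{(u)}(\xi)=\log(1-u+ue^{\xi})$; $C_{\mathcal G}^{(q)}(\xi)=\log\frac{q}{1-(1-q)e^{\xi}}$ for $\xi<-\log(1-q)$ and $\infty$ otherwise. The critical slope is $$k^{(u)}(\xi)=\Big(\frac{\partial}{\partial u}C_{\mathcal B}^{(u)}(\xi)\Big)\Big/\Big(\frac{\partial}{\partial u}C_{\mathcal G}^{\left(\frac{u-p}{u(1-p)}\right)}(-\xi)\Big),$$ and $k^{(u)}(-\xi)$ is given by the same expression with $\xi$ replaced by $-\xi$. $\Lambda_{(s,t)}(\xi)$ is the limiting log-moment generating function of the model without boundaries: with $\{\tilde\omega_v\}_{v\in\mathbb Z_+^2}$ i.i.d. Bernoulli($p$) and $\tilde G_{m,n}$ the last passage time from $(0,0)$ to $(m,n)$, defined as the maximum over up-right paths of $\sum_i\tilde\omega_{v_{i+1}}\mathbf 1\{v_{i+1}-v_i=e_1\}$, $\Lambda_{(s,t)}(\xi)=\lim_{N\to\infty}N^{-1}\log\mathbb E\,e^{\xi\tilde G_{\lfloor Ns\rfloor,\lfloor Nt\rfloor}}$ (this limit exists).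
   Formalization: In the passage times with boundary, ⌊Ns⌋ and ⌊Nt⌋ are replaced by max(1,⌊Ns⌋) and max(1,⌊Nt⌋), since for s=0 or t=0 the maxima are empty or involve no path (no change in the limits for s,t>0); at ξ=0 the slope k, which is 0/0, is taken as 0 (all branches are 0). *)

(* Defs.v *)
From HB Require Import structures.
From mathcomp Require Import all_boot all_order all_algebra.
From mathcomp Require Import all_classical all_reals all_analysis.

Set Implicit Arguments.
Unset Strict Implicit.
Unset Printing Implicit Defensive.

Import Order.TTheory GRing.Theory Num.Theory.
Import numFieldNormedType.Exports.

Local Open Scope classical_set_scope.
Local Open Scope ring_scope.

(* An up-right path of length k from v is encoded by its steps b : k.-tuple
   bool, true standing for e_1 and false for e_2. *)
Definition path_site (v : nat * nat) (b : seq bool) (i : nat) : nat * nat :=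
  ((v.1 + count id (take i b))%N, (v.2 + count negb (take i b))%N).

Definition path_weight (w : nat * nat -> nat) (v : nat * nat) (b : seq bool) :
    nat :=
  (\sum_(0 <= i < size b | nth false b i) w (path_site v b i.+1))%N.

(* Every up-right path from v to z has length (z.1 - v.1) + (z.2 - v.2). *)
Definition last_passage (w : nat * nat -> nat) (v z : nat * nat) : nat :=
  (\max_(b : ((z.1 - v.1) + (z.2 - v.2)).-tuple bool
           | path_site v b (size b) == z) path_weight w v b)%N.

Definition G_hor (w : nat * nat -> nat) (z : nat * nat) : nat :=
  (\max_(1 <= k < z.1.+1)
     (\sum_(1 <= i < k.+1) w (i, 0) + last_passage w (k, 1) z))%N.

Definition G_ver (w : nat * nat -> nat) (z : nat * nat) : nat :=
  (\max_(1 <= l < z.2.+1)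
     (\sum_(1 <= j < l.+1) w (0, j) + w (1, l) + last_passage w (1, l) z))%N.

Definition scaled_site {R : realType} (s t : R) (N : nat) : nat * nat :=
  (Num.truncn (N%:R * s), Num.truncn (N%:R * t)).

(* G_hor and G_ver only make sense at endpoints with both coordinates at least
   1: otherwise they are maxima over an empty set, or involve passage times
   between sites not joined by any path. Coordinates equal to 0 are therefore
   replaced by 1. If s, t > 0 this changes only finitely many N, hence not the
   limits; it gives the passage times a meaning when s = 0 or t = 0. *)
Definition scaled_site1 {R : realType} (s t : R) (N : nat) : nat * nat :=
  (maxn 1 (scaled_site s t N).1, maxn 1 (scaled_site s t N).2)%N.

Section Environment.
Context {d : measure_display} {T : measurableType d} {R : realType}.
Variable P : probability T R.

(* Every subset of nat is measurable. *)
Definition mutually_independent (I : eqType) (X : I -> {RV P >-> nat}) : Prop :=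
  forall (J : seq I) (B : I -> set nat), uniq J ->
    P (\big[setI/setT]_(i <- J) (X i @^-1` B i)) =
    (\prod_(i <- J) P (X i @^-1` B i))%E.

Definition has_Bernoulli_law (X : {RV P >-> nat}) (p : R) : Prop :=
  forall b : bool, distribution P X [set nat_of_bool b] = (bernoulli_pmf p b)%:E.

(* The geometric law on {0, 1, 2, ...}, with success probability q. *)
Definition has_Geometric_law (X : {RV P >-> nat}) (q : R) : Prop :=
  forall l : nat, distribution P X [set l] = (q * (1 - q) ^+ l)%:E.

(* (1/N) log E[exp(xi G_N)], in the extended reals. *)
Definition log_mgf_rate (G : nat -> T -> nat) (xi : R) (N : nat) : \bar R :=
  ((N%:R^-1)%:E * lne ('M_P (fun x => (G N x)%:R) xi))%E.

End Environment.

(* The parameter of the geometric boundary weights. *)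
Definition geom_param {R : realType} (p u : R) : R := (u - p) / (u * (1 - p)).

Definition bulk_env {d : measure_display} {T : measurableType d} {R : realType}
    (P : probability T R) (p : R) (w : nat * nat -> {RV P >-> nat}) : Prop :=
  mutually_independent w /\ forall v, has_Bernoulli_law (w v) p.

Definition boundary_env {d : measure_display} {T : measurableType d}
    {R : realType} (P : probability T R) (p u : R)
    (w : nat * nat -> {RV P >-> nat}) : Prop :=
  [/\ mutually_independent w,
      forall i j, has_Bernoulli_law (w (i.+1, j.+1)%N) p,
      forall i, has_Bernoulli_law (w (i.+1, 0)%N) u,
      forall j, has_Geometric_law (w (0, j.+1)%N) (geom_param p u) &
      forall x, w (0, 0)%N x = 0%N].

Definition C_Ber {R : realType} (u xi : R) : R := ln (1 - u + u * expR xi).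

Definition C_Geo {R : realType} (q xi : R) : \bar R :=
  if xi < - ln (1 - q) then (ln (q / (1 - (1 - q) * expR xi)))%:E else +oo%E.

(* At the arguments where the critical slope is used, C_Geo is finite in a
   neighbourhood of u. At xi = 0 the quotient is 0 / 0, that is 0; all branches
   of the limit shape then agree. *)
Definition critical_slope {R : realType} (p u xi : R) : R :=
  derive1 (fun v : R => C_Ber v xi) u /
  derive1 (fun v : R => fine (C_Geo (geom_param p v) (- xi))) u.

Definition Lambda {d : measure_display} {T : measurableType d} {R : realType}
    (P : probability T R) (w : nat * nat -> {RV P >-> nat}) (s t xi : R) :
    \bar R :=
  limn (log_mgf_rate P (fun N x =>
    last_passage (fun v => w v x) (0, 0)%N (scaled_site s t N)) xi).

(* Main.v *)
Require Import Defs.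
From mathcomp Require Import all_boot all_order all_algebra.
From mathcomp Require Import all_classical all_reals all_analysis.
From mathcomp Require Import measurable_realfun.
From mathcomp Require Import zify ring lra.
Import Order.TTheory GRing.Theory Num.Theory.
Import numFieldNormedType.Exports.
Local Open Scope classical_set_scope.
Local Open Scope ring_scope.

Set Implicit Arguments.
Unset Strict Implicit.
Unset Printing Implicit Defensive.

(** Fix [z = exp xi] and let [mgf p z m n] be the expectation of [z] to the power of
    the passage time over an [m] by [n] box of Bernoulli weights of parameter [p].
    Paths can be concatenated, so the logarithm of [mgf] is superadditive and has a
    rate of growth [f (s, t)] along every direction, which is the limiting log-moment
    generating function of the model without boundaries. The function [f] is
    homogeneous and superadditive, hence concave ([rate], [rate_hom], [rate_super],
    [log_mgf_growth]).

    Information on [f] comes from the models with boundaries, for all parameters [v]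
    in [(p, 1)] at once. By Burke's property ([Ex_incs]) the horizontal increments of
    the passage time [G] with both boundaries are, along every row, independent
    Bernoulli variables of parameter [v]. Hence [z] to the power of [G] minus the sum
    of the weights of the vertical axis has expectation [B ^ m], where
    [B = 1 - v + v z] ([Ex_burke]). An optimal path leaves the axes at one of at most
    [m + n] sites, and what it collects afterwards is independent of the axes. With
    [c v] the logarithm of [B] and [g v] the log-moment generating function of the
    geometric weights at [- xi], the exact formula therefore yields two estimates
    ([mgf_upper], [mgf_lower]): [f (s, t) <= s c v - t g v] for all [v], and, for
    every [v], equality in some direction. If equality holds in the direction [(s, t)]
    for the parameter [u], then [u] minimizes [s c v - t g v] over [v], so that
    [t / s = c' u / g' u]: the direction is the critical slope ([rate_critical]).

    The moment generating function of the passage time with a first step to the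
    right lies, up to a factor of order [m], at the largest of the products of
    [B ^ k] and of [mgf] on the box that remains after leaving the axis at [k].
    Its rate is therefore the supremum over [a] in [[0, s]] of
    [a c u + f (s - a, t)]. Below the critical ray it is attained where
    [(s - a, t)] lies on the ray, which gives [s c u - t g u]; above, concavity of
    [f] forces [a = 0] and gives [f (s, t)] ([cvg_exit]).

    Vertical exits are the same problem with the two axes exchanged, along the curve
    formed by minus the log-moment generating functions of the Bernoulli weights at
    [- xi] and of the geometric ones at [xi]. This is again the curve [(c, g)], with
    the odds of the parameter multiplied by [exp (- xi)] ([tilt_spec]), so that the
    estimates on [mgf] apply unchanged. When the geometric weights have no
    exponential moment at [xi], the first of them makes everything infinite.

    Expectations of functions of finitely many sites are computed as iterated series
    ([Ex]), which are available for every parameter [v] without building a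
    probability space, and agree with the integrals over the given spaces by
    conditioning on one site after the other ([integral_Ex]). *)

Local Notation env := (nat * nat -> nat).

(** * Last passage times by recursion *)

Section LastPassage.
Local Open Scope nat_scope.
Implicit Types (e : env) (v : nat * nat).

(** The last step to the right is taken at height [b]. *)
Fixpoint lp e v (i j : nat) : nat :=
  if i is i'.+1 then \max_(b < j.+1) (lp e v i' b + e (v.1 + i, v.2 + b))
  else 0.

Lemma lpS0 e v i : lp e v i.+1 0 = lp e v i 0 + e (v.1 + i.+1, v.2).
Proof. by rewrite /= big_ord_recr big_ord0 /= max0n addn0. Qed.

Lemma lpSS e v i j :
  lp e v i.+1 j.+1 =
  maxn (lp e v i.+1 j) (lp e v i j.+1 + e (v.1 + i.+1, v.2 + j.+1)).
Proof. by rewrite [LHS]/= big_ord_recr. Qed.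

Lemma lp_right e v i j : lp e v i j + e (v.1 + i.+1, v.2 + j) <= lp e v i.+1 j.
Proof.
by case: j => [|j]; [rewrite lpS0 addn0|rewrite lpSS leq_maxr].
Qed.

Lemma lp_up e v i j : lp e v i j <= lp e v i j.+1.
Proof. by case: i => // i; rewrite lpSS leq_maxl. Qed.

Lemma lp_le e v i i' j j' : i <= i' -> j <= j' -> lp e v i j <= lp e v i' j'.
Proof.
move=> ii' jj'; apply: (@leq_trans (lp e v i j')).
  by elim: j' jj' => [|j' IH]; rewrite leq_eqVlt => /orP[/eqP->|] // /IH h;
     apply: (leq_trans h); exact: lp_up.
elim: i' ii' => [|i' IH]; rewrite leq_eqVlt => /orP[/eqP->|] // /IH h.
by apply: (leq_trans h); apply: leq_trans (lp_right _ _ _ _); exact: leq_addr.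
Qed.

Lemma lp_le_intro e v (B : nat -> nat -> nat) :
  (forall i j, B i j + e (v.1 + i.+1, v.2 + j) <= B i.+1 j) ->
  (forall i j, B i j <= B i j.+1) ->
  forall i j, lp e v i j <= B i j.
Proof.
move=> Br Bu; elim=> [|i IH] // j.
elim: j => [|j IHj].
  rewrite lpS0; apply: leq_trans (Br i 0); by rewrite addn0 leq_add2r.
rewrite lpSS geq_max (leq_trans IHj (Bu _ _)) /=.
by apply: leq_trans (Br i j.+1); rewrite leq_add2r.
Qed.

(** Two optimal paths can be concatenated: every superadditivity below comes from
    this. *)
Lemma lp_cat e v i1 j1 i2 j2 :
  lp e v i1 j1 + lp e (v.1 + i1, v.2 + j1) i2 j2 <= lp e v (i1 + i2) (j1 + j2).
Proof.
have mono a b : lp e v i1 j1 <= lp e v (i1 + a) (j1 + b).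
  by apply: lp_le; exact: leq_addr.
rewrite -leq_subRL //; move: i2 j2.
apply: lp_le_intro => [i j|i j] /=.
  have := lp_right e v (i1 + i) (j1 + j); have := mono i j.
  rewrite -addnS !addnA => h1 h2.
  by rewrite addnBAC // leq_sub2r.
by apply: leq_sub2r; rewrite addnS lp_up.
Qed.

Lemma lp_ext e e' v i j :
  (forall a b, v.1 < a <= v.1 + i -> v.2 <= b <= v.2 + j ->
     e (a, b) = e' (a, b)) ->
  lp e v i j = lp e' v i j.
Proof.
elim: i j => [|i IH] // j h /=; apply: eq_bigr => b _; congr (_ + _).
  by apply: IH => a c ? ?; apply: h; have := ltn_ord b; lia.
by apply: h; have := ltn_ord b; lia.
Qed.

Lemma lp_shift e v i j :
  lp e v i j = lp (fun x => e (v.1 + x.1, v.2 + x.2)) (0, 0) i j.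
Proof. by elim: i j => [|i IH] // j /=; apply: eq_bigr => b _; rewrite IH. Qed.

(** * Lattice paths *)

Lemma path_weight_rcons e v b x :
  path_weight e v (rcons b x) =
  path_weight e v b + x * e (path_site v (rcons b x) (size b).+1).
Proof.
rewrite /path_weight size_rcons big_mkcond big_nat_recr //= [in RHS]big_mkcond.
congr (_ + _).
  apply: eq_big_nat => i /andP[_ ib].
  by rewrite nth_rcons ib /path_site -cats1 takel_cat.
by rewrite nth_rcons ltnn eqxx; case: x; rewrite ?mul1n ?mul0n.
Qed.

Lemma path_site_size v b :
  path_site v b (size b) = (v.1 + count id b, v.2 + count negb b).
Proof. by rewrite /path_site take_size. Qed.

Lemma path_weight_le e v b :
  path_weight e v b <= lp e v (count id b) (count negb b).
Proof.
elim/last_ind: b => [|b x IH]; first by rewrite /path_weight big_geq.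
rewrite path_weight_rcons -(size_rcons b x) path_site_size.
rewrite -cats1 !count_cat /=; case: x => /=; rewrite ?mul1n ?mul0n !addn0 ?addn1.
  by apply: leq_trans (lp_right _ _ _ _); rewrite leq_add2r.
by apply: leq_trans IH (lp_up _ _ _ _).
Qed.

Lemma path_weight_lp e v i j :
  exists b, [/\ count id b = i, count negb b = j & path_weight e v b = lp e v i j].
Proof.
elim: i j => [|i IH] j.
  exists (nseq j false); rewrite !count_nseq mul1n; split=> //.
  rewrite /path_weight big_nat_cond big1 // => k /andP[_].
  by rewrite nth_nseq; case: ifP.
elim: j => [|j IHj].
  have [b [b1 b2 b3]] := IH 0; exists (rcons b true).
  rewrite lpS0 path_weight_rcons -(size_rcons b true) path_site_size b3.
  by rewrite -cats1 !count_cat /= b1 b2 mul1n !addn0 addn1.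
rewrite lpSS; case: leqP => _.
  have [b [b1 b2 b3]] := IH j.+1; exists (rcons b true).
  rewrite path_weight_rcons -(size_rcons b true) path_site_size b3.
  by rewrite -cats1 !count_cat /= b1 b2 mul1n !addn0 addn1.
have [b [b1 b2 b3]] := IHj; exists (rcons b false).
rewrite path_weight_rcons b3 mul0n.
by rewrite -cats1 !count_cat /= b1 b2 !addn0 addn1.
Qed.

Lemma last_passageE e v i j :
  last_passage e v (v.1 + i, v.2 + j) = lp e v i j.
Proof.
rewrite /last_passage /= !addKn; apply/eqP; rewrite eqn_leq; apply/andP; split.
  apply/bigmax_leqP => b; rewrite path_site_size => /eqP[/addnI bi /addnI bj].
  by have := path_weight_le e v b; rewrite bi bj.
have [b [b1 b2 b3]] := path_weight_lp e v i j.
have sb : size b == i + j by rewrite -b1 -b2 -(count_predC id b).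
rewrite -b3; apply: (@leq_bigmax_cond _ _ _ (Tuple sb)).
by rewrite path_site_size /= b1 b2.
Qed.

(** * Passage times with weights on both axes *)

Definition hsum e k := \sum_(1 <= i < k.+1) e (i, 0).
Definition vsum e l := \sum_(1 <= j < l.+1) e (0, j).

(** Passage times from the origin when the steps along both axes collect the
    weights of the axes. *)
Fixpoint gb e (i j : nat) : nat :=
  if i is i'.+1 then
    maxn (hsum e i) (\max_(b < j) (gb e i' b.+1 + e (i, b.+1)))
  else vsum e j.

Lemma hsumS e k : hsum e k.+1 = hsum e k + e (k.+1, 0).
Proof. by rewrite /hsum big_nat_recr. Qed.

Lemma vsumS e l : vsum e l.+1 = vsum e l + e (0, l.+1).
Proof. by rewrite /vsum big_nat_recr. Qed.

Lemma gb0 e i : gb e i 0 = hsum e i.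
Proof.
by case: i => [|i] /=; rewrite ?big_ord0 ?maxn0 // /vsum /hsum !big_geq.
Qed.

Lemma gbSS e i j :
  gb e i.+1 j.+1 = maxn (gb e i.+1 j) (gb e i j.+1 + e (i.+1, j.+1)).
Proof. by rewrite [LHS]/= big_ord_recr maxnA. Qed.

Lemma gb_up e i j : gb e i j <= gb e i j.+1.
Proof. by case: i => [|i]; rewrite ?gbSS ?leq_maxl //= vsumS leq_addr. Qed.

Lemma gb_right e i j : gb e i j <= gb e i.+1 j.
Proof.
case: j => [|j]; first by rewrite !gb0 hsumS leq_addr.
by rewrite gbSS leq_max leq_addr orbT.
Qed.

Lemma gb_ext e e' i j :
  (forall a b, a <= i -> b <= j -> e (a, b) = e' (a, b)) ->
  gb e i j = gb e' i j.
Proof.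
have hE k : (forall a b, a <= k -> b <= j -> e (a, b) = e' (a, b)) ->
    hsum e k = hsum e' k.
  by move=> h; apply: eq_big_nat => a ?; apply: h; lia.
elim: i => [|i IH] in j hE *.
  by move=> h; apply: eq_big_nat => b ?; apply: h; lia.
move=> h /=; congr maxn; first exact: hE.
apply: eq_bigr => b _; congr (_ + _); last by apply: h; have := ltn_ord b; lia.
have bj := ltn_ord b.
apply: IH => [k h'|a c ai cb]; last by apply: h; lia.
by apply: eq_big_nat => a ?; apply: h'; lia.
Qed.

Arguments gb : simpl never.
Arguments lp : simpl never.

(** The increments along the rows evolve like a discrete time queue: [I] and [J]
    are the increments on the south and west sides of a unit square, and the
    right-hand sides those on its north and east sides. *)
Lemma gb_row_step e i j :
  let I := gb e i.+1 j - gb e i j in let J := gb e i j.+1 - gb e i j in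
  gb e i.+1 j.+1 - gb e i j.+1 = maxn (e (i.+1, j.+1)) (I - J) /\
  gb e i.+1 j.+1 - gb e i.+1 j = J + e (i.+1, j.+1) - I.
Proof.
move=> I J; rewrite /I /J gbSS; have := gb_up e i j; have := gb_right e i j; lia.
Qed.

Lemma lp_le_gb e m n : lp e (0, 1) m n <= gb e m n.+1.
Proof.
apply: (@lp_le_intro e (0, 1) (fun m n => gb e m n.+1)) => i j /=.
  by rewrite gbSS add0n add1n leq_maxr.
exact: gb_up.
Qed.

(** By induction on the last step. A path leaving the vertical axis is bounded by
    one over the box starting on that axis, rather than one column to its right:
    the first step to the right collects [e (1, l)] anyway. *)
Lemma gb_exit e m n : 0 < m -> 0 < n ->
  (exists2 k, 0 < k <= m & gb e m n <= hsum e k + lp e (k, 1) (m - k) n.-1) \/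
  (exists2 l, 0 < l <= n & gb e m n <= vsum e l + lp e (0, l) m (n - l)).
Proof.
case: m => // m _; case: n => // n _; elim: m n => [|m IHm] n; elim: n => [|n IHn];
  rewrite gbSS; case: leqP => _ /=.
- by right; exists 1 => //; rewrite subnn lpS0.
- by left; exists 1 => //; rewrite gb0 leq_addr.
- by right; exists n.+2; rewrite ?leqnn // subnn lpS0.
- case: IHn => -[k /andP[k0 km] h]; [left|right]; exists k; rewrite ?k0 ?km //.
  + by apply: (leq_trans h); rewrite leq_add2l; apply: lp_up.
  + exact: leqW.
  + by apply: (leq_trans h); rewrite leq_add2l [_.+2 - _]subSn //; exact: lp_up.
- case: (IHm 0) => -[k /andP[k0 km] h]; [left|right]; exists k;
    rewrite ?k0 ?km ?(leqW km) //.
  + rewrite [_.+2 - _]subSn //; apply: leq_trans (leq_add (leqnn _) (lp_right _ _ _ _)) => /=.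
    by rewrite -subSn // subnKC ?(leqW km) // addnA leq_add2r.
  + apply: leq_trans (leq_add (leqnn _) (lp_right _ _ _ _)) => /=.
    by rewrite subnKC // addnA leq_add2r.
- by left; exists m.+2; rewrite ?leqnn // gb0 leq_addr.
- case: (IHm n.+1) => -[k /andP[k0 km] h]; [left|right]; exists k;
    rewrite ?k0 ?km ?(leqW km) //.
  + rewrite [_.+2 - _]subSn //; apply: leq_trans (leq_add (leqnn _) (lp_right _ _ _ _)) => /=.
    by rewrite -subSn // subnKC ?(leqW km) // addnA leq_add2r.
  + apply: leq_trans (leq_add (leqnn _) (lp_right _ _ _ _)) => /=.
    by rewrite subnKC // addnA leq_add2r.
- case: IHn => -[k /andP[k0 km] h]; [left|right]; exists k; rewrite ?k0 ?km //.
  + by apply: (leq_trans h); rewrite leq_add2l; apply: lp_up.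
  + exact: leqW.
  + by apply: (leq_trans h); rewrite leq_add2l [_.+2 - _]subSn //; exact: lp_up.
Qed.

Lemma bigmax_nat_attained (m : nat) (F : nat -> nat) : 0 < m ->
  exists2 k, 0 < k <= m & \max_(1 <= k < m.+1) F k = F k.
Proof.
case: m => // m _; elim: m => [|m [k /andP[k0 km] IH]].
  by exists 1 => //; rewrite big_nat1.
rewrite big_nat_recr //= {}IH.
case: leqP => _; [exists m.+2 => //; exact: leqnn|exists k => //].
by rewrite k0 leqW.
Qed.

Lemma leq_bigmax_nat1 (m k : nat) (F : nat -> nat) : 0 < k <= m ->
  F k <= \max_(1 <= k < m.+1) F k.
Proof.
by move=> km; apply: leq_bigmax_seq => //; rewrite mem_index_iota.
Qed.

Lemma G_horE e m n : 0 < n ->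
  G_hor e (m, n) =
  \max_(1 <= k < m.+1) (hsum e k + lp e (k, 1) (m - k) n.-1).
Proof.
move=> n0; apply: eq_big_nat => k /andP[_ km]; congr (_ + _).
by rewrite -last_passageE /= subnKC // add1n prednK.
Qed.

Lemma G_verE e m n : 0 < m ->
  G_ver e (m, n) =
  \max_(1 <= l < n.+1) (vsum e l + e (1, l) + lp e (1, l) m.-1 (n - l)).
Proof.
move=> m0; apply: eq_big_nat => l /andP[_ ln]; congr (_ + _).
by rewrite -last_passageE /= subnKC // add1n prednK.
Qed.

End LastPassage.

Arguments gb : simpl never.
Arguments lp : simpl never.

(** * Iterated expectations over finitely many sites *)

Lemma ge0_nneseriesZl (R : realType) (f : nat -> \bar R) (x : \bar R) :
  (0 <= x)%E -> (forall i, 0 <= f i)%E ->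
  (\sum_(0 <= i <oo) (x * f i) = x * \sum_(0 <= i <oo) f i)%E.
Proof.
case: x => [x _ f0||] //; first by apply: nneseriesZl.
move=> _ f0; have [[k fk]|nex] := pselect (exists k, f k != 0%E).
  have fk0 : (0 < f k)%E by rewrite lt0e fk f0.
  rewrite (@nneseries_pinfty _ (fun i => +oo * f i)%E _ k) ?gt0_mulye // => [|n _].
    apply: lt_le_trans fk0 _; apply: le_trans (nneseries_lim_ge k.+1 _) => //.
    by rewrite big_nat_recr //= leeDr // sume_ge0.
  by rewrite mule_ge0.
have f00 i : f i = 0%E by apply/eqP/negPn/negP => h; apply: nex; exists i.
by rewrite !eseries0 ?mule0 // => i _ _; rewrite f00 ?mule0.
Qed.

Definition upd (e : env) (v : nat * nat) (a : nat) : env :=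
  fun x => if x == v then a else e x.

Lemma upd_same e v a : upd e v a v = a.
Proof. by rewrite /upd eqxx. Qed.

Lemma upd_other e v a x : x != v -> upd e v a x = e x.
Proof. by rewrite /upd => /negbTE ->. Qed.

Definition depends_on {A} (K : pred (nat * nat)) (phi : env -> A) : Prop :=
  forall e e', (forall x, K x -> e x = e' x) -> phi e = phi e'.

Section IteratedExpectation.
Variable R : realType.
Implicit Types (mu : nat * nat -> nat -> R) (J : seq (nat * nat)) (e : env).
Implicit Types (phi psi : env -> \bar R).
Local Open Scope ereal_scope.

(** The sites of [J] are integrated from the last one to the first, the others being
    frozen at their values in [e]. *)
Fixpoint Ex mu J phi e : \bar R :=
  if J is v :: J' then
    \sum_(0 <= a <oo) (mu v a)%:E * Ex mu J' phi (upd e v a)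
  else phi e.

Definition is_law mu : Prop :=
  (forall v a, 0 <= mu v a)%R /\ (forall v, \sum_(0 <= a <oo) (mu v a)%:E = 1).

Variable mu : nat * nat -> nat -> R.
Hypothesis lawmu : is_law mu.

Let mu0 v a : 0 <= (mu v a)%:E.
Proof. by rewrite lee_fin; apply: lawmu.1. Qed.

Lemma Ex_ge0 J phi e : (forall e, 0 <= phi e) -> 0 <= Ex mu J phi e.
Proof.
move=> h; elim: J e => [|v J IH] e //=.
by apply: nneseries_ge0 => a _ _; rewrite mule_ge0.
Qed.

Lemma Ex_cat J1 J2 phi e :
  Ex mu (J1 ++ J2) phi e = Ex mu J1 (fun e => Ex mu J2 phi e) e.
Proof. by elim: J1 e => [|v J1 IH] e //=; apply: eq_eseriesr => a _; rewrite IH. Qed.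

Lemma Ex_ext J phi psi e :
  (forall e', (forall x, x \notin J -> e' x = e x) -> phi e' = psi e') ->
  Ex mu J phi e = Ex mu J psi e.
Proof.
elim: J e => [|v J IH] e h /=; first by apply: h.
apply: eq_eseriesr => a _; congr (_ * _); apply: IH => e' h'; apply: h => x.
by rewrite inE negb_or => /andP[xv xJ]; rewrite h' // upd_other.
Qed.

Lemma Ex_le J phi psi e : (forall e, 0 <= phi e) ->
  (forall e', phi e' <= psi e') -> Ex mu J phi e <= Ex mu J psi e.
Proof.
move=> phi0 h; elim: J e => [|v J IH] e //=.
apply: lee_nneseries => [a _ _|a _]; first by rewrite mule_ge0 // Ex_ge0.
by rewrite lee_pmul // Ex_ge0.
Qed.

Lemma Ex_sum J (I : Type) (r : seq I) (phi : I -> env -> \bar R) e :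
  (forall i e, 0 <= phi i e) ->
  Ex mu J (fun e => \sum_(i <- r) phi i e) e = \sum_(i <- r) Ex mu J (phi i) e.
Proof.
move=> phi0; elim: J e => [|v J IH] e //=.
rewrite -nneseries_sum => [|i a _]; last by rewrite mule_ge0 // Ex_ge0.
apply: eq_eseriesr => a _; rewrite IH ge0_sume_distrr // => i _; exact: Ex_ge0.
Qed.

Lemma ExD J phi psi e : (forall e, 0 <= phi e) -> (forall e, 0 <= psi e) ->
  Ex mu J (fun e => phi e + psi e) e = Ex mu J phi e + Ex mu J psi e.
Proof.
move=> phi0 psi0; elim: J e => [|v J IH] e //=.
rewrite -nneseriesD => [|a _ _|a _ _]; try by rewrite mule_ge0 // Ex_ge0.
by apply: eq_eseriesr => a _; rewrite IH ge0_muleDr // Ex_ge0.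
Qed.

Lemma Ex_depends J K phi : depends_on K phi ->
  depends_on (fun x => K x && (x \notin J)) (Ex mu J phi).
Proof.
move=> dphi; elim: J => [|v J IH] e e' h /=.
  by apply: dphi => x Kx; apply: h; rewrite Kx.
apply: eq_eseriesr => a _; congr (_ * _); apply: IH => x /andP[Kx xJ].
rewrite /upd; case: eqP => // /eqP xv; apply: h.
by rewrite Kx inE negb_or xv.
Qed.

Lemma Ex_mass v x : 0 <= x -> \sum_(0 <= a <oo) (mu v a)%:E * x = x.
Proof.
move=> x0; under eq_eseriesr do rewrite muleC.
by rewrite ge0_nneseriesZl // lawmu.2 mule1.
Qed.

(** At each site one of the two factors is constant and can be taken out of the
    series. *)
Lemma Ex_indep J K L phi psi e :
  depends_on K phi -> depends_on L psi -> (forall x, K x -> ~~ L x) ->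
  (forall e, 0 <= phi e) -> (forall e, 0 <= psi e) ->
  Ex mu J (fun e => phi e * psi e) e = Ex mu J phi e * Ex mu J psi e.
Proof.
move=> dphi dpsi KL phi0 psi0; elim: J e => [|v J IH] e //=.
under eq_eseriesr do rewrite IH.
have depE M (chi : env -> \bar R) a : ~~ M v -> depends_on M chi ->
    Ex mu J chi (upd e v a) = Ex mu J chi e.
  move=> Mv dchi; refine (@Ex_depends J _ _ dchi _ _ _) => x /andP[Mx _].
  by rewrite upd_other //; apply: contraTneq Mx => ->.
have [Kv|Kv] := boolP (K v).
  under [X in _ = _ * X]eq_eseriesr do rewrite (depE _ _ _ (KL _ Kv) dpsi).
  rewrite [X in _ = _ * X]Ex_mass ?Ex_ge0 //.
  rewrite muleC -ge0_nneseriesZl ?Ex_ge0 // => [|a]; last first.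
    by rewrite mule_ge0 // Ex_ge0.
  apply: eq_eseriesr => a _.
  by rewrite (depE _ _ _ (KL _ Kv) dpsi) muleA muleC.
under [X in _ = X * _]eq_eseriesr do rewrite (depE _ _ _ Kv dphi).
rewrite [X in _ = X * _]Ex_mass ?Ex_ge0 //.
rewrite -ge0_nneseriesZl ?Ex_ge0 // => [|a]; last first.
  by rewrite mule_ge0 // Ex_ge0.
by apply: eq_eseriesr => a _; rewrite (depE _ _ _ Kv dphi) muleCA.
Qed.

Lemma Ex_drop J K phi e : depends_on K phi -> (forall e, 0 <= phi e) ->
  Ex mu J phi e = Ex mu [seq x <- J | K x] phi e.
Proof.
move=> dphi phi0; elim: J e => [|v J IH] e //=.
have [Kv|Kv] := boolP (K v) => /=.
  by apply: eq_eseriesr => a _; rewrite IH.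
rewrite -IH -[RHS](Ex_mass v) ?Ex_ge0 //; apply: eq_eseriesr => a _.
congr (_ * _); refine (@Ex_depends J _ _ dphi _ _ _) => x /andP[Kx _].
by rewrite upd_other //; apply: contraTneq Kx => ->.
Qed.

Lemma Ex_swap v v' J phi e : v != v' -> (forall e, 0 <= phi e) ->
  Ex mu (v :: v' :: J) phi e = Ex mu (v' :: v :: J) phi e.
Proof.
move=> vv' phi0.
have E2 v1 v2 : Ex mu (v1 :: v2 :: J) phi e = \sum_(0 <= a <oo)
    \sum_(0 <= b <oo) (mu v1 a)%:E * ((mu v2 b)%:E *
      Ex mu J phi (upd (upd e v1 a) v2 b)).
  apply: eq_eseriesr => a _; rewrite nneseriesZl // => b _.
  by rewrite mule_ge0 // Ex_ge0.
rewrite !E2 nneseries_interchange => [|a b]; last by rewrite !mule_ge0 // Ex_ge0.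
apply: eq_eseriesr => b _; apply: eq_eseriesr => a _; rewrite muleCA.
congr (_ * (_ * _)); congr (Ex _ _ _ _); apply/funext => x; rewrite /upd.
by case: (eqVneq x v') => // ->; case: (eqVneq v' v) vv' => // ->; rewrite eqxx.
Qed.

Lemma Ex_perm J J' phi e : (forall e, 0 <= phi e) -> uniq J -> perm_eq J J' ->
  Ex mu J phi e = Ex mu J' phi e.
Proof.
move=> phi0; elim: J' J e => [|v J' IH] J e uJ.
  by move/perm_nilP => ->.
move=> JJ'; have vJ : v \in J by rewrite (perm_mem JJ') mem_head.
move: vJ uJ JJ' => /splitPr[J1 J2] uJ.
rewrite perm_catC /= perm_cons perm_catC => JJ'.
have -> : Ex mu (J1 ++ v :: J2) phi e = Ex mu (v :: J1 ++ J2) phi e.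
  move: uJ {JJ'}; elim: J1 e => [|v1 J1 IH1] e //=.
  rewrite mem_cat inE !negb_or => /andP[/and3P[_ v1v _] uJ].
  under eq_eseriesr do rewrite IH1 //.
  exact: (@Ex_swap v1 v (J1 ++ J2)).
rewrite /=; apply: eq_eseriesr => a _; congr (_ * _); apply: IH => //.
by move: uJ; rewrite -cat1s uniq_catCA cat1s cons_uniq => /andP[].
Qed.

(** This allows boxes of different sizes to be compared: ignored sites have total
    mass one, and the order of integration does not matter. *)
Lemma Ex_support J K phi e e' : (forall e, 0 <= phi e) -> uniq J -> uniq K ->
  {subset K <= J} -> depends_on (fun x => x \in K) phi ->
  Ex mu J phi e = Ex mu K phi e'.
Proof.
move=> phi0 uJ uK KJ dphi; rewrite (@Ex_drop J _ _ e dphi) //.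
rewrite (@Ex_perm _ K) ?filter_uniq //; last first.
  apply: uniq_perm; rewrite ?filter_uniq // => x.
  by rewrite mem_filter; apply: andb_idr; exact: KJ.
by refine (@Ex_depends K _ _ dphi _ _ _) => x /andP[xK]; rewrite xK.
Qed.

Lemma Ex_cst J (k : R) e : (0 <= k)%R -> Ex mu J (fun=> k%:E) e = k%:E.
Proof.
by move=> k0; elim: J e => [|v J IH] e //=; under eq_eseriesr do rewrite IH;
  rewrite Ex_mass ?lee_fin.
Qed.

Lemma Ex_site J v (h : nat -> \bar R) e : (forall a, 0 <= h a) ->
  uniq J -> v \in J ->
  Ex mu J (fun e => h (e v)) e = \sum_(0 <= a <oo) (mu v a)%:E * h a.
Proof.
move=> h0 uJ vJ; rewrite (@Ex_support _ [:: v] _ _ e) //=.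
- by apply: eq_eseriesr => a _; rewrite upd_same.
- by move=> x; rewrite inE => /eqP->.
- by move=> e1 e2 he; rewrite he //= inE.
Qed.

End IteratedExpectation.

(** Boxes at different places are compared by translating the sites. *)
Lemma Ex_map (R : realType) (mu : nat * nat -> nat -> R) (s : nat * nat -> nat * nat)
    J (phi : env -> \bar R) e : injective s ->
  Ex mu [seq s x | x <- J] (fun e => phi (e \o s)) e =
  Ex (mu \o s) J phi (e \o s).
Proof.
move=> inj; elim: J e => [|v J IH] e //=.
apply: eq_eseriesr => a _; congr (_ * _)%E; rewrite IH; congr (Ex _ _ _ _).
by apply/funext => x; rewrite /upd /= (inj_eq inj).
Qed.

Lemma eq_Ex (R : realType) (mu nu : nat * nat -> nat -> R) J (phi : env -> \bar R) e :
  (forall v, v \in J -> mu v = nu v) -> Ex mu J phi e = Ex nu J phi e.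
Proof.
elim: J e => [|v J IH] e h //=.
apply: eq_eseriesr => a _; rewrite (h v (mem_head _ _)) IH // => x xJ.
by apply: h; rewrite inE xJ orbT.
Qed.

(** * Burke's property of one row *)

Section Burke.
Variable R : realType.
Implicit Types (phi : nat -> nat -> \bar R) (psi : seq nat -> \bar R).
Local Open Scope ereal_scope.

Definition bern (q : R) (a : nat) : R :=
  (if a is 0 then 1 - q else if a is 1 then q else 0)%R.

Definition geo (q : R) (a : nat) : R := (q * (1 - q) ^+ a)%R.

Lemma bern_series q (h : nat -> \bar R) :
  (0 <= q <= 1)%R -> (forall a, 0 <= h a) ->
  \sum_(0 <= a <oo) (bern q a)%:E * h a = (1 - q)%:E * h 0%N + q%:E * h 1%N.
Proof.
move=> /andP[q0 q1] h0; rewrite (nneseries_split _ 2); last first.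
  by move=> [|[|k]] _; rewrite mule_ge0 // lee_fin /= ?subr_ge0.
rewrite eseries0 ?adde0 => [|[|[|k]] // _ _]; last by rewrite mul0e.
by rewrite add0n big_nat_recr //= big_nat1.
Qed.

Lemma geo_series (q r : R) : (0 <= q)%R -> (0 <= r < 1)%R ->
  \sum_(0 <= a <oo) (q * r ^+ a)%:E = (q / (1 - r))%:E.
Proof.
move=> q0 /andP[r0 r1].
have /cvg_geometric_series-/(_ q) h : (`|r| < 1)%R by rewrite ger0_norm.
apply: cvg_lim => //; apply: cvg_EFin.
  by apply: nearW => n; rewrite sumEFin.
apply: cvg_trans h; apply: near_eq_cvg; apply: nearW => n.
by rewrite /= sumEFin /series /=.
Qed.

Variables p v : R.
Hypothesis p01 : (0 < p)%R.
Hypothesis pv : (p < v < 1)%R.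

Let q := geom_param p v.

Let v0 : (0 < v)%R. Proof. by have /andP[h _] := pv; apply: lt_trans h. Qed.
Let v1 : (v < 1)%R. Proof. by have /andP[] := pv. Qed.
Let pv' : (p < v)%R. Proof. by have /andP[] := pv. Qed.
Let p1 : (p < 1)%R. Proof. by have /andP[h h'] := pv; apply: lt_trans h'. Qed.

Lemma geom_paramC : (1 - geom_param p v = p * (1 - v) / (v * (1 - p)))%R.
Proof. by rewrite /geom_param; field; rewrite !gt_eqF ?subr_gt0. Qed.

Lemma geom_param_gt0 : (0 < geom_param p v)%R.
Proof. by rewrite /geom_param divr_gt0 ?mulr_gt0 ?subr_gt0. Qed.

Lemma geom_paramC_gt0 : (0 < 1 - geom_param p v)%R.
Proof. by rewrite geom_paramC divr_gt0 ?mulr_gt0 ?subr_gt0. Qed.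

Lemma geo_ge0 a : (0 <= geo q a)%R.
Proof. by rewrite /geo mulr_ge0 ?exprn_ge0 // ltW // ?geom_param_gt0 ?geom_paramC_gt0. Qed.

Let r : R := (p * (1 - v) / (v * (1 - p)))%R.

(** In [burke_local], [x] and [y] are the series of [phi 0 a] and [phi 1 a.+1] against
    the geometric law, and [z] is the term of [phi 1 0]. *)
Lemma burke_algebra (x y z : \bar R) : 0 <= x -> 0 <= y -> 0 <= z ->
  (1 - v)%:E * ((1 - p)%:E * x + p%:E * y) +
  v%:E * ((1 - p)%:E * (z + r%:E * x) + p%:E * (z + r%:E * y)) =
  (1 - v)%:E * x + v%:E * (z + r%:E * y).
Proof.
have r0 : (0 < r)%R by rewrite /r -geom_paramC geom_paramC_gt0.
have v1' : (0 < 1 - v)%R by rewrite subr_gt0.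
have p1' : (0 < 1 - p)%R by rewrite subr_gt0.
move: x y z => [x||] [y||] [z||] //= x0 y0 z0.
all: rewrite ?(gt0_muley, gt0_mulye) ?lte_fin ?r0 //.
all: rewrite -?EFinM -?EFinD ?(gt0_muley, addye, addey) ?lte_fin //.
by congr EFin; rewrite /r; field; rewrite !gt_eqF ?subr_gt0.
Qed.

(** Crossing one unit square preserves the product law of the horizontal and vertical
    increments. The ratio [r] of the geometric law is the one that makes
    [v * (1 - p) * r = p * (1 - v)]: the exchanges of mass between the two values of
    the horizontal increment then balance. *)
Lemma burke_local phi : (forall a b, 0 <= phi a b) ->
  \sum_(0 <= x <oo) (bern v x)%:E * (\sum_(0 <= a <oo) (geo q a)%:E *
    (\sum_(0 <= o <oo) (bern p o)%:E * phi (maxn o (x - a)) (a + o - x)%N)) =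
  \sum_(0 <= x <oo) (bern v x)%:E * (\sum_(0 <= a <oo) (geo q a)%:E * phi x a).
Proof.
move=> phi0.
have v01 : (0 <= v <= 1)%R by rewrite !ltW.
have p01' : (0 <= p <= 1)%R by rewrite !ltW.
have g0 a : 0 <= (geo q a)%:E by rewrite lee_fin geo_ge0.
have gS a : (geo q a.+1)%:E = r%:E * (geo q a)%:E.
  by rewrite /geo exprSr mulrA geom_paramC -EFinM mulrC.
have b0 o : 0 <= (bern p o)%:E by rewrite lee_fin; case: o => [|[|o]] //=; rewrite ?subr_ge0 ltW.
set T1 := \sum_(0 <= a <oo) (geo q a)%:E * phi 0%N a.
set T2 := \sum_(0 <= a <oo) (geo q a)%:E * phi 1%N a.+1.
set z := (geo q 0)%:E * phi 1%N 0%N.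
have rsum h : (forall a, 0 <= h a) -> \sum_(0 <= a <oo) (geo q a)%:E * h a =
    (geo q 0)%:E * h 0%N + r%:E * \sum_(0 <= a <oo) (geo q a)%:E * h a.+1.
  move=> h0; rewrite nneseries_recl => [|a _|//]; last by rewrite mule_ge0.
  congr (_ + _); rewrite -nneseriesZl => [|a _]; last by rewrite mule_ge0.
  rewrite -(nneseries_addn _ (fun a => mule_ge0 (g0 a) (h0 a))).
  by apply: eq_eseriesr => a _; rewrite addn1 gS muleA.
have -> : \sum_(0 <= x <oo) (bern v x)%:E *
    (\sum_(0 <= a <oo) (geo q a)%:E * phi x a) =
    (1 - v)%:E * T1 + v%:E * (z + r%:E * T2).
  rewrite bern_series //; first by congr (_ + _ * _); rewrite rsum.
  by move=> a; apply: nneseries_ge0 => b _ _; rewrite mule_ge0.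
rewrite -burke_algebra ?mule_ge0 ?nneseries_ge0 //; try by move=> *; rewrite mule_ge0.
rewrite bern_series //; last first.
  move=> x; apply: nneseries_ge0 => a _ _; rewrite mule_ge0 //.
  by apply: nneseries_ge0 => o _ _; rewrite mule_ge0.
have split2 (c d : R) (h k : nat -> \bar R) : (0 <= c)%R -> (0 <= d)%R ->
    (forall a, 0 <= h a) -> (forall a, 0 <= k a) ->
    \sum_(0 <= a <oo) (geo q a)%:E * (c%:E * h a + d%:E * k a) =
    c%:E * \sum_(0 <= a <oo) (geo q a)%:E * h a +
    d%:E * \sum_(0 <= a <oo) (geo q a)%:E * k a.
  move=> c0 d0 h0 k0; rewrite -!nneseriesZl => [|a _|a _]; try by rewrite mule_ge0.
  rewrite -nneseriesD => [|a _ _|a _ _]; try by rewrite !mule_ge0.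
  apply: eq_eseriesr => a _; rewrite ge0_muleDr ?mule_ge0 //.
  by rewrite muleCA (muleCA _ d%:E).
congr (_ * _ + _ * _).
  rewrite -split2 ?subr_ge0 ?ltW //.
  by apply: eq_eseriesr => a _; rewrite bern_series // sub0n !subn0 addn0 addn1 maxn0.
have -> : z + r%:E * T1 =
    \sum_(0 <= a <oo) (geo q a)%:E * phi (1 - a)%N (a - 1)%N.
  rewrite [RHS]rsum //; congr (_ + _ * _).
  by apply: eq_eseriesr => a _; rewrite subn1.
have -> : z + r%:E * T2 = \sum_(0 <= a <oo) (geo q a)%:E * phi 1%N a.
  by rewrite [RHS]rsum.
rewrite -split2 ?subr_ge0 ?ltW //.
apply: eq_eseriesr => a _; rewrite bern_series // max0n addn0 addnK.
by rewrite (maxn_idPl _) // leq_subr.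
Qed.

Fixpoint Ebern m psi : \bar R :=
  if m is m'.+1 then
    \sum_(0 <= x <oo) (bern v x)%:E * Ebern m' (fun s => psi (x :: s))
  else psi [::].

(** Expectation over a row of the increments on its north side, given the
    increments [I] on its south side and the first vertical increment [a]. *)
Fixpoint Erow (I : seq nat) (a : nat) psi : \bar R :=
  if I is x :: I' then
    \sum_(0 <= o <oo) (bern p o)%:E *
      Erow I' (a + o - x) (fun s => psi (maxn o (x - a) :: s))
  else psi [::].

Let bp0 o : 0 <= (bern p o)%:E.
Proof. by rewrite lee_fin; case: o => [|[|o]] //=; rewrite ?subr_ge0 ltW. Qed.

Let bv0 o : 0 <= (bern v o)%:E.
Proof. by rewrite lee_fin; case: o => [|[|o]] //=; rewrite ?subr_ge0 ltW. Qed.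

Lemma Ebern_ge0 m psi : (forall s, 0 <= psi s) -> 0 <= Ebern m psi.
Proof.
elim: m psi => [|m IH] psi psi0 //=; apply: nneseries_ge0 => x _ _.
by rewrite mule_ge0 // IH.
Qed.

Lemma Erow_ge0 I a psi : (forall s, 0 <= psi s) -> 0 <= Erow I a psi.
Proof.
elim: I a psi => [|x I IH] a psi psi0 //=; apply: nneseries_ge0 => o _ _.
by rewrite mule_ge0 // IH.
Qed.

Lemma eq_Ebern m psi psi' : psi =1 psi' -> Ebern m psi = Ebern m psi'.
Proof. by move=> /funext ->. Qed.

Lemma Ebern_series m (c : nat -> R) (psi : nat -> seq nat -> \bar R) :
  (forall a, 0 <= c a)%R -> (forall a s, 0 <= psi a s) ->
  Ebern m (fun s => \sum_(0 <= a <oo) (c a)%:E * psi a s) =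
  \sum_(0 <= a <oo) (c a)%:E * Ebern m (psi a).
Proof.
move=> c0; elim: m psi => [|m IH] psi psi0 //=.
have ce0 a : 0 <= (c a)%:E by rewrite lee_fin.
under eq_eseriesr => x _.
  rewrite IH //= -nneseriesZl => [|a _].
    over.
  by rewrite mule_ge0 // Ebern_ge0.
rewrite nneseries_interchange => [|x a]; last by rewrite !mule_ge0 // Ebern_ge0.
apply: eq_eseriesr => a _; rewrite -nneseriesZl => [|x _]; last first.
  by rewrite mule_ge0 // Ebern_ge0.
by apply: eq_eseriesr => x _; rewrite muleCA.
Qed.

(** Induction along the row: once the first square has been crossed, [burke_local]
    restores the product law of the remaining horizontal increments and of the
    next vertical one. *)
Lemma burke_row m psi : (forall s, 0 <= psi s) ->
  Ebern m (fun I => \sum_(0 <= a <oo) (geo q a)%:E * Erow I a psi) =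
  Ebern m psi.
Proof.
have geo_mass : \sum_(0 <= a <oo) (geo q a)%:E = 1.
  rewrite geo_series ?(ltW geom_param_gt0) //; last first.
    by rewrite (ltW geom_paramC_gt0) gtrBl geom_param_gt0.
  by rewrite opprB addrCA subrr addr0 divff // gt_eqF // geom_param_gt0.
have g0 a : 0 <= (geo q a)%:E by rewrite lee_fin geo_ge0.
elim: m psi => [|m IH] psi psi0 /=.
  under eq_eseriesr do rewrite muleC.
  by rewrite ge0_nneseriesZl // geo_mass mule1.
pose phi b a := Ebern m (fun I => Erow I a (fun s => psi (b :: s))).
transitivity (\sum_(0 <= x <oo) (bern v x)%:E *
    (\sum_(0 <= a <oo) (geo q a)%:E * phi x a)).
  rewrite -burke_local => [|b a]; last first.
    by apply: Ebern_ge0 => I; exact: Erow_ge0.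
  apply: eq_eseriesr => x _; congr (_ * _).
  rewrite Ebern_series //=; last first.
    move=> a s; apply: nneseries_ge0 => o _ _.
    by rewrite mule_ge0 // Erow_ge0.
  apply: eq_eseriesr => a _; congr (_ * _).
  by rewrite Ebern_series // => k s; exact: Erow_ge0.
apply: eq_eseriesr => x _; congr (_ * _); rewrite -(IH (fun s => psi (x :: s))) //.
by rewrite Ebern_series // => a s; exact: Erow_ge0.
Qed.

Lemma Ebern_prod m (z : R) : (0 <= z)%R ->
  Ebern m (fun s => (z ^+ sumn s)%:E) = ((1 - v + v * z) ^+ m)%:E.
Proof.
move=> z0; suff h c : (0 <= c)%R ->
    Ebern m (fun s => (c * z ^+ sumn s)%:E) = (c * (1 - v + v * z) ^+ m)%:E.
  by have := h 1%R ler01; under eq_Ebern do rewrite mul1r; rewrite mul1r.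
elim: m c => [|m IH] c c0 //=.
have v01 : (0 <= v <= 1)%R by rewrite !ltW.
rewrite bern_series // => [|a]; last first.
  by apply: Ebern_ge0 => s; rewrite lee_fin mulr_ge0 // exprn_ge0.
under eq_Ebern do rewrite add0n.
under [X in _ + _ * X]eq_Ebern do rewrite add1n exprS mulrA.
rewrite !IH ?mulr_ge0 // -!EFinM -EFinD; congr EFin.
by rewrite exprS; ring.
Qed.

End Burke.

(** * The environment with boundaries *)

Section Sites.
Local Open Scope nat_scope.

Definition row_sites (m j : nat) := [seq (i.+1, j) | i <- iota 0 m].

Fixpoint sites m n : seq (nat * nat) :=
  if n is n'.+1 then sites m n' ++ (0, n) :: row_sites m n else row_sites m 0.

Lemma mem_row_sites m j x : (x \in row_sites m j) = (0 < x.1 <= m) && (x.2 == j).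
Proof.
apply/mapP/andP => [[i + ->]|].
  by rewrite mem_iota add0n /= => im; split.
case: x => [[|i] k] /= [im /eqP->] //; exists i => //.
by rewrite mem_iota.
Qed.

Lemma row_sites_uniq m j : uniq (row_sites m j).
Proof. by rewrite map_inj_uniq ?iota_uniq // => i i' []. Qed.

Lemma mem_sites m n x :
  (x \in sites m n) = [&& x.1 <= m, x.2 <= n & x != (0, 0)].
Proof.
elim: n => [|n IH] /=.
  by rewrite mem_row_sites leqn0; case: x => [[|i] [|j]] //=; rewrite ?andbT ?andbF.
rewrite mem_cat IH inE mem_row_sites {IH}.
by case: x => [[|i] [|j]] //=; rewrite ?xpair_eqE ?andbT ?andbF ?orbF //=; lia.
Qed.

Lemma sites_uniq m n : uniq (sites m n).
Proof.
elim: n => [|n IH] /=; first exact: row_sites_uniq.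
rewrite cat_uniq IH /= row_sites_uniq andbT mem_row_sites /= andbT.
apply/norP; split; first by rewrite mem_sites /= ltnn.
apply/hasPn => x; rewrite mem_row_sites mem_sites => /andP[_ /eqP->].
by rewrite ltnn andbF.
Qed.

Definition incs (e : env) i0 k j := [seq gb e i.+1 j - gb e i j | i <- iota i0 k].

Lemma gb_west_le e m j : gb e 0 j <= gb e m j.
Proof. by elim: m => // k IH; apply: leq_trans IH (gb_right _ _ _). Qed.

Lemma sumn_incs e m j : sumn (incs e 0 m j) = gb e m j - gb e 0 j.
Proof.
have mono := gb_west_le e ^~ j.
elim: m => [|m IH]; first by rewrite subnn.
rewrite /incs -addn1 iotaD map_cat sumn_cat IH /= add0n addn0.
have := gb_right e m j; have := mono m; rewrite !addn1. lia.
Qed.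

(** The first column of the box is left out: paths only go up in it, for free. *)
Definition lp_box (w : nat * nat) m n (x : nat * nat) : bool :=
  ((w.1 < x.1 <= w.1 + m) && (w.2 <= x.2 <= w.2 + n)).

Lemma lp_depends w m n : depends_on (lp_box w m n) (fun e => lp e w m n).
Proof.
move=> e e' h; apply: lp_ext => a b ha hb; apply: h.
by rewrite /lp_box /= ha hb.
Qed.

Lemma sites_box w m n m' n' x :
  (w.1 + m <= m') -> (w.2 + n <= n') -> lp_box w m n x -> x \in sites m' n'.
Proof.
case: x => [[|i] j]; rewrite /lp_box mem_sites xpair_eqE /= ?andbF ?andbT //; lia.
Qed.

End Sites.

Section Environment.
Variable R : realType.
Variables p v : R.
Hypothesis p01 : (0 < p)%R.
Hypothesis pv : (p < v < 1)%R.
Local Open Scope ereal_scope.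

Let q := geom_param p v.

(** [bern 0] is the Dirac mass at zero. *)
Definition bdry_law (x : nat * nat) : nat -> R :=
  match x with
  | (0, 0) => bern 0
  | (i.+1, 0) => bern v
  | (0, j.+1) => geo q
  | (i.+1, j.+1) => bern p
  end%N.

Let v0 : (0 < v)%R. Proof. by have /andP[h _] := pv; apply: lt_trans h. Qed.
Let v1 : (v < 1)%R. Proof. by have /andP[] := pv. Qed.
Let p1 : (p < 1)%R. Proof. by have /andP[h h'] := pv; apply: lt_trans h'. Qed.

Lemma bern_ge0 (r : R) a : (0 <= r <= 1)%R -> (0 <= bern r a)%R.
Proof. by move=> /andP[? ?]; case: a => [|[|a]] //=; rewrite subr_ge0. Qed.

Lemma bern_mass (r : R) : (0 <= r <= 1)%R -> \sum_(0 <= a <oo) (bern r a)%:E = 1.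
Proof.
move=> r01; transitivity (\sum_(0 <= a <oo) (bern r a)%:E * 1).
  by apply: eq_eseriesr => a _; rewrite mule1.
by rewrite bern_series // !mule1 -EFinD subrK.
Qed.

Lemma geo_mass : \sum_(0 <= a <oo) (geo q a)%:E = 1.
Proof.
have q0 := geom_param_gt0 p01 pv; have q1 := geom_paramC_gt0 p01 pv.
rewrite geo_series ?(ltW q0) //; last by rewrite (ltW q1) gtrBl.
by rewrite opprB addrCA subrr addr0 divff // gt_eqF.
Qed.

Lemma bdry_is_law : is_law bdry_law.
Proof.
have v01 : (0 <= v <= 1)%R by rewrite !ltW.
have p01' : (0 <= p <= 1)%R by rewrite !ltW.
have o01 : (0 <= (0 : R) <= 1)%R by rewrite lexx ler01.
split=> [[[|i] [|j]] a|[[|i] [|j]]] /=;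
  by [exact: bern_ge0|exact: bern_mass|exact: geo_mass|exact: geo_ge0].
Qed.

Lemma Ex_bottom_row psi e k i0 : (forall s, 0 <= psi s) ->
  Ex bdry_law [seq (i.+1, 0%N) | i <- iota i0 k]
     (fun e => psi (incs e i0 k 0)) e = Ebern v k psi.
Proof.
elim: k i0 psi e => [|k IH] i0 psi e psi0 //=.
apply: eq_eseriesr => a _; congr (_ * _).
rewrite -(IH i0.+1 (fun s => psi (a :: s)) (upd e (i0.+1, 0%N) a)) //.
apply: Ex_ext => e' he'; congr (psi (_ :: _)).
rewrite !gb0 hsumS addKn he' ?upd_same //.
by apply/mapP => -[i]; rewrite mem_iota => /andP[h _] [ii]; rewrite ii ltnn in h.
Qed.

Lemma Ex_row psi e k i0 j : (forall s, 0 <= psi s) ->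
  Ex bdry_law [seq (i.+1, j.+1) | i <- iota i0 k]
     (fun e => psi (incs e i0 k j.+1)) e =
  Erow p (incs e i0 k j) (gb e i0 j.+1 - gb e i0 j) psi.
Proof.
elim: k i0 psi e => [|k IH] i0 psi e psi0 //=.
apply: eq_eseriesr => a _; congr (_ * _).
set e1 := upd e (i0.+1, j.+1) a.
have gbE i' j' : (i' <= i0)%N || (j' <= j)%N -> gb e1 i' j' = gb e i' j'.
  move=> h; apply: gb_ext => b c bi cj; rewrite /e1 upd_other // xpair_eqE.
  by move: h bi cj; lia.
have e1v : e1 (i0.+1, j.+1) = a by rewrite /e1 upd_same.
have [] := gb_row_step e1 i0 j; rewrite e1v.
rewrite (gbE i0 j) ?(gbE i0 j.+1) ?(gbE i0.+1 j) ?leqnn ?orbT // => hI hJ.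
rewrite -hI -hJ -(gbE i0.+1 j) ?leqnn ?orbT //.
have -> : [seq (gb e i.+1 j - gb e i j)%N | i <- iota i0.+1 k] = incs e1 i0.+1 k j.
  by apply: eq_map => i; rewrite !gbE ?leqnn ?orbT.
rewrite -(IH i0.+1 (fun s => psi (_ :: s)) e1) //.
apply: Ex_ext => e' he'; congr (psi (_ :: _)).
have out b c : (b <= i0.+1)%N -> e' (b, c) = e1 (b, c).
  move=> bi; apply: he'; apply/mapP => -[i]; rewrite mem_iota => /andP[h _] [bE _].
  by rewrite bE ltnS leqNgt h in bi.
rewrite -(gbE i0 j.+1) ?leqnn //; congr (_ - _)%N; apply: gb_ext => b c bi _;
  by rewrite out // leqW.
Qed.

(** Induction on the rows: given the rows below, the increments of a row are produced
    by [Erow] from those of the preceding one. *)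
Lemma Ex_incs m n psi e : (forall s, 0 <= psi s) ->
  Ex bdry_law (sites m n) (fun e => psi (incs e 0 m n)) e = Ebern v m psi.
Proof.
elim: n psi e => [|n IH] psi e psi0 /=; first exact: Ex_bottom_row.
rewrite Ex_cat -(burke_row p01 pv m psi0).
rewrite -(IH (fun I => \sum_(0 <= a <oo) (geo q a)%:E * Erow p I a psi) e); last first.
  move=> s; apply: nneseries_ge0 => a _ _.
  by rewrite mule_ge0 ?lee_fin ?geo_ge0 //; apply: (Erow_ge0 p01 pv).
apply: Ex_ext => e1 _ /=; apply: eq_eseriesr => a _; congr (_ * _).
rewrite Ex_row //; congr (Erow _ _ _ _).
  apply: eq_map => i; congr (_ - _)%N; apply: gb_ext => b c _ cn;
    by rewrite upd_other //; apply/eqP => -[_ cE]; rewrite cE ltnn in cn.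
by rewrite /gb vsumS addKn upd_same.
Qed.

(** The increments of the top row add up to the passage time minus the sum of the
    weights of the vertical axis. *)
Lemma Ex_burke m n (z : R) e : (0 <= z)%R ->
  Ex bdry_law (sites m n) (fun e => (z ^+ (gb e m n - gb e 0 n))%:E) e =
  ((1 - v + v * z) ^+ m)%:E.
Proof.
move=> z0; rewrite -(Ebern_prod p01 pv m z0).
rewrite -(@Ex_incs m n _ e) => [|s]; last by rewrite lee_fin exprn_ge0.
by apply: Ex_ext => e' _; rewrite sumn_incs.
Qed.

End Environment.

(** * Moment generating functions of boxes *)

Section Bulk.
Variable R : realType.
Variable p : R.
Hypothesis p01 : (0 < p < 1)%R.
Local Open Scope ereal_scope.

Lemma bern_is_law : is_law (fun=> bern p).
Proof.
have p01' : (0 <= p <= 1)%R by have /andP[? ?] := p01; rewrite !ltW.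
by split=> [_ a|_]; [exact: bern_ge0|exact: bern_mass].
Qed.

Variable z : R.
Hypothesis z1 : (1 <= z)%R.

Let z0 : (0 < z)%R. Proof. by apply: lt_le_trans z1. Qed.
Let zX0 k : (0 <= z ^+ k)%R. Proof. by rewrite exprn_ge0 // ltW. Qed.

(** [z] stands for the exponential of the variable of the moment generating
    function. *)
Definition mgf m n : \bar R :=
  Ex (fun=> bern p) (sites m n) (fun e => (z ^+ lp e (0, 0)%N m n)%:E) (fun=> 0%N).

Lemma Ex_lp mu J w m n e : is_law mu -> uniq J ->
  (forall x, lp_box w m n x -> x \in J /\ mu x = bern p) ->
  Ex mu J (fun e => (z ^+ lp e w m n)%:E) e = mgf m n.
Proof.
move=> lmu uJ hJ.
pose K := [seq x <- sites m n | (0 < x.1)%N].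
have uK : uniq K by rewrite filter_uniq ?sites_uniq.
have KE x : (x \in K) = lp_box (0, 0)%N m n x.
  by case: x => [[|i] [|j]]; rewrite mem_filter mem_sites /lp_box /= ?add0n ?andbT.
pose s (x : nat * nat) := (w.1 + x.1, w.2 + x.2)%N.
have sinj : injective s by move=> [a b] [c d] [/addnI -> /addnI ->].
have boxs x : lp_box (0, 0)%N m n x = lp_box w m n (s x).
  by rewrite /lp_box /s /=; lia.
pose phi (e : env) := (z ^+ lp e (0, 0)%N m n)%:E.
have phi0 e' : 0 <= phi e' by rewrite lee_fin.
transitivity (Ex mu [seq s x | x <- K] (fun e => phi (e \o s)) e).
  have -> : (fun e => (z ^+ lp e w m n)%:E) = (fun e => phi (e \o s)).
    by apply/funext => e'; rewrite /phi lp_shift.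
  apply: Ex_support => //; rewrite ?map_inj_uniq //.
    by move=> x /mapP[y]; rewrite KE boxs => /hJ[? _] ->.
  move=> e1 e2 h; congr ((z ^+ _)%:E); apply: lp_depends => x.
  by rewrite -KE => xK; apply: h; rewrite map_f.
rewrite Ex_map // (@eq_Ex _ _ (fun=> bern p)); last first.
  by move=> x; rewrite KE boxs => /hJ[].
apply/esym; apply: Ex_support => //; rewrite ?sites_uniq //.
- exact: bern_is_law.
- by move=> x; rewrite mem_filter => /andP[].
- by move=> e1 e2 h; congr ((z ^+ _)%:E); apply: lp_depends => x; rewrite -KE => /h.
Qed.

Lemma mgf_ge1 m n : 1 <= mgf m n.
Proof.
rewrite -(Ex_cst bern_is_law (sites m n) (fun=> 0%N) (@ler01 R)).
apply: Ex_le => // [|e]; first exact: bern_is_law.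
by rewrite lee_fin exprn_ege1.
Qed.

Lemma mgf_le m n m' n' : (m <= m')%N -> (n <= n')%N -> mgf m n <= mgf m' n'.
Proof.
move=> mm' nn'.
rewrite -(@Ex_lp (fun=> bern p) (sites m' n') (0, 0)%N m n (fun=> 0%N)
  bern_is_law (sites_uniq _ _)); last by move=> x hx; split=> //; apply: sites_box hx.
apply: Ex_le => // [|e|e]; rewrite ?lee_fin //; first exact: bern_is_law.
by rewrite ler_weXn2l // lp_le.
Qed.

(** The boxes of two consecutive paths have no column in common, so that the passage
    times over them are independent. *)
Lemma mgf_superM m1 n1 m2 n2 : mgf m1 n1 * mgf m2 n2 <= mgf (m1 + m2) (n1 + n2).
Proof.
rewrite -(@Ex_lp (fun=> bern p) (sites (m1 + m2) (n1 + n2)) (0, 0)%N m1 n1 (fun=> 0%N)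
  bern_is_law (sites_uniq _ _)); last first.
  by move=> x hx; split=> //; apply: sites_box hx; rewrite add0n leq_addr.
rewrite -(@Ex_lp (fun=> bern p) (sites (m1 + m2) (n1 + n2)) (m1, n1) m2 n2 (fun=> 0%N)
  bern_is_law (sites_uniq _ _)); last first.
  by move=> x hx; split=> //; apply: sites_box hx.
rewrite -(@Ex_indep _ _ bern_is_law _ (lp_box (0, 0)%N m1 n1) (lp_box (m1, n1) m2 n2)) //.
- apply: Ex_le => // [|e|e]; first exact: bern_is_law.
    by rewrite -EFinM lee_fin mulr_ge0.
  rewrite -EFinM lee_fin -exprD ler_weXn2l //.
  by apply: leq_trans (lp_cat _ _ _ _ _ _); rewrite leqnn.
- by move=> e e' h; congr ((z ^+ _)%:E); apply: lp_depends.
- by move=> e e' h; congr ((z ^+ _)%:E); apply: lp_depends.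
- by move=> x; rewrite /lp_box /=; lia.
- by move=> e; rewrite lee_fin.
- by move=> e; rewrite lee_fin.
Qed.

End Bulk.

(** * Bounds from the model with boundaries *)

Section Exponents.
Variable R : realType.
Variables p v z : R.
Hypothesis p0 : (0 < p)%R.
Hypothesis pv : (p < v < 1)%R.
Hypothesis z1 : (1 <= z)%R.
Local Open Scope ereal_scope.

Let z0 : (0 < z)%R. Proof. by apply: lt_le_trans z1. Qed.
Let zX0 k : (0 <= z ^+ k)%R. Proof. by rewrite exprn_ge0 // ltW. Qed.
Let zV0 k : (0 <= z^-1 ^+ k)%R. Proof. by rewrite exprn_ge0 // invr_ge0 ltW. Qed.
Let v01 : (0 < v < 1)%R.
Proof. by have /andP[h ->] := pv; rewrite (lt_trans p0 h). Qed.
Let p01 : (0 < p < 1)%R.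
Proof. by have /andP[h h'] := pv; rewrite p0 (lt_trans h h'). Qed.

Let mu := bdry_law p v.
Let lawmu : is_law mu := bdry_is_law p0 pv.

Definition geo_mgf (y : R) : R :=
  (geom_param p v / (1 - (1 - geom_param p v) * y))%R.

Definition bern_mgf (y : R) : R := (1 - v + v * y)%R.

Lemma bdry_law_box w m n x : (0 < w.2)%N -> lp_box w m n x -> mu x = bern p.
Proof.
by case: w x => [a [|b]] // [[|i] [|j]] _; rewrite /lp_box /= ?ltn0 ?andbF.
Qed.

Lemma Ex_pow J s a k (y A : R) e : (0 <= y)%R -> uniq J -> injective s ->
  (forall j, (a <= j < a + k)%N ->
     s j \in J /\ \sum_(0 <= x <oo) (mu (s j) x * y ^+ x)%:E = A%:E) ->
  Ex mu J (fun e => (y ^+ (\sum_(a <= j < a + k) e (s j))%N)%:E) e = (A ^+ k)%:E.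
Proof.
move=> y0 uJ sinj; have yX0 n : (0 <= y ^+ n)%R by rewrite exprn_ge0.
elim: k => [|k IH] h.
  rewrite addn0 expr0 -(Ex_cst lawmu J e (@ler01 R)).
  by apply: Ex_ext => e' _; rewrite big_geq.
transitivity (Ex mu J (fun e => (y ^+ (\sum_(a <= j < a + k) e (s j))%N)%:E *
    (y ^+ e (s (a + k)%N))%:E) e).
  apply: Ex_ext => e' _; rewrite -EFinM -exprD addnS big_nat_recr //=.
  exact: leq_addr.
rewrite (@Ex_indep _ _ lawmu _ (fun x => x \in [seq s j | j <- index_iota a (a + k)])
  (pred1 (s (a + k)%N))).
- rewrite IH => [|j /andP[aj jk]]; last by apply: h; rewrite aj addnS ltnW.
  have [sJ sA] : s (a + k)%N \in J /\
      \sum_(0 <= x <oo) (mu (s (a + k)%N) x * y ^+ x)%:E = A%:E.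
    by apply: h; rewrite leq_addr addnS /=.
  rewrite (Ex_site lawmu (h := fun n => (y ^+ n)%:E)) // exprSr EFinM.
  by congr (_ * _); rewrite -sA; apply: eq_eseriesr => x _; rewrite EFinM.
- move=> e1 e2 h12; congr ((y ^+ _)%:E); apply: eq_big_nat => j hj; apply: h12.
  by rewrite map_f // mem_index_iota.
- by move=> e1 e2 h12; congr ((y ^+ _)%:E); apply: h12; rewrite /= eqxx.
- move=> x /mapP[j]; rewrite mem_index_iota => /andP[_ jk] -> /=.
  by rewrite (inj_eq sinj) ltn_eqF.
- by move=> e1; rewrite lee_fin.
- by move=> e1; rewrite lee_fin.
Qed.

Lemma geo_law_mgf y : (0 <= y)%R -> ((1 - geom_param p v) * y < 1)%R ->
  \sum_(0 <= x <oo) (geo (geom_param p v) x * y ^+ x)%:E = (geo_mgf y)%:E.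
Proof.
move=> y0 hy; rewrite -geo_series ?(ltW (geom_param_gt0 p0 pv)) //; last first.
  by rewrite hy mulr_ge0 // (ltW (geom_paramC_gt0 p0 pv)).
by apply: eq_eseriesr => x _; rewrite /geo exprMn mulrA.
Qed.

Lemma bern_law_mgf y : (0 <= y)%R ->
  \sum_(0 <= x <oo) (bern v x * y ^+ x)%:E = (bern_mgf y)%:E.
Proof.
move=> y0; have /andP[v0 v1] := v01.
under eq_eseriesr do rewrite EFinM.
rewrite (bern_series (h := fun x => (y ^+ x)%:E)) ?(ltW v0) ?(ltW v1) //.
  by rewrite -!EFinM -EFinD mulr1.
by move=> a; rewrite lee_fin exprn_ge0.
Qed.

Lemma geo_ratio_inv : ((1 - geom_param p v) * z^-1 < 1)%R.
Proof.
apply: le_lt_trans (_ : 1 - geom_param p v < 1)%R.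
  by rewrite ler_piMr ?invf_le1 // ltW // (geom_paramC_gt0 p0 pv).
by rewrite gtrBl (geom_param_gt0 p0 pv).
Qed.

Lemma Ex_hsum m n k e : (k <= m)%N ->
  Ex mu (sites m n) (fun e => (z ^+ hsum e k)%:E) e = (bern_mgf z ^+ k)%:E.
Proof.
move=> km; apply: (@Ex_pow _ (fun i => (i, 0%N)) 1 k).
- exact: ltW.
- exact: sites_uniq.
- by move=> i j [].
- move=> [|j] // /andP[_ jk]; split; last exact: bern_law_mgf (ltW z0).
  by rewrite mem_sites /= andbT; lia.
Qed.

Lemma Ex_vsum m n l k y e : (0 <= y)%R -> ((1 - geom_param p v) * y < 1)%R ->
  (l + k <= n)%N ->
  Ex mu (sites m n) (fun e => (y ^+ (\sum_(l.+1 <= j < l.+1 + k) e (0, j)))%:E) e =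
  (geo_mgf y ^+ k)%:E.
Proof.
move=> y0 hy lk; apply: (@Ex_pow _ (fun j => (0%N, j))) => //.
- exact: sites_uniq.
- by move=> i j [].
- move=> [|j] // /andP[_ jk]; split; last exact: geo_law_mgf.
  by rewrite mem_sites /=; lia.
Qed.


Let g0 : (0 < geom_param p v)%R := geom_param_gt0 p0 pv.

Lemma geo_mgf_gt0 y : ((1 - geom_param p v) * y < 1)%R -> (0 < geo_mgf y)%R.
Proof. by move=> hy; rewrite divr_gt0 // subr_gt0. Qed.

Lemma exp_gb e m n :
  (z ^+ (gb e m n - gb e 0 n) = z ^+ gb e m n * z^-1 ^+ vsum e n)%R.
Proof. by rewrite exprB ?gb_west_le ?unitfE ?gt_eqF // exprVn. Qed.

(** The box lies to the right of the vertical axis, so that the two factors are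
    independent. *)
Lemma Ex_vsum_lp m n w m' n' l k y e : (0 <= y)%R ->
  ((1 - geom_param p v) * y < 1)%R -> (l + k <= n)%N ->
  (0 < w.2)%N -> (w.1 + m' <= m)%N -> (w.2 + n' <= n)%N ->
  Ex mu (sites m n) (fun e =>
     (y ^+ (\sum_(l.+1 <= j < l.+1 + k) e (0, j))%N)%:E * (z ^+ lp e w m' n')%:E) e =
  (geo_mgf y ^+ k)%:E * mgf p z m' n'.
Proof.
move=> y0 hy lk w2 wm wn.
rewrite (@Ex_indep _ _ lawmu _ (fun x => x.1 == 0%N) (lp_box w m' n')).
- rewrite Ex_vsum // (Ex_lp p01 z1 _ lawmu (sites_uniq m n)) // => x hx.
  by split; [exact: (sites_box wm wn hx)|exact: bdry_law_box hx].
- move=> e1 e2 h; congr ((y ^+ _)%:E); apply: eq_bigr => j _; exact: h.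
- by move=> e1 e2 h; congr ((z ^+ _)%:E); apply: lp_depends.
- by move=> [i j] /= /eqP->; rewrite /lp_box /=.
- by move=> e1; rewrite lee_fin exprn_ge0.
- by move=> e1; rewrite lee_fin.
Qed.

(** A path leaving the vertical axis at height one is admissible, which bounds
    the moment generating function without boundaries. *)
Lemma mgf_upper m n :
  (geo_mgf z^-1 ^+ n.+1)%:E * mgf p z m n <= (bern_mgf z ^+ m)%:E.
Proof.
have zV : (0 <= z^-1)%R by rewrite invr_ge0 ltW.
rewrite -(@Ex_burke _ _ _ p0 pv m n.+1 z (fun=> 0%N) (ltW z0)).
rewrite -(@Ex_vsum_lp m n.+1 (0, 1)%N m n 0 n.+1 _ (fun=> 0%N) zV geo_ratio_inv) //.
apply: Ex_le => // [e|e]; rewrite -EFinM lee_fin ?mulr_ge0 //.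
rewrite exp_gb mulrC ler_wpM2r // ler_weXn2l //; exact: lp_le_gb.
Qed.

Lemma Ex_hor_term m n k e : (k <= m)%N -> (0 < n)%N ->
  Ex mu (sites m n) (fun e => (z ^+ (hsum e k + lp e (k, 1%N) (m - k) n.-1))%:E) e =
  (bern_mgf z ^+ k)%:E * mgf p z (m - k) n.-1.
Proof.
move=> km n0.
transitivity (Ex mu (sites m n) (fun e =>
    (z ^+ hsum e k)%:E * (z ^+ lp e (k, 1%N) (m - k) n.-1)%:E) e).
  by apply: Ex_ext => e' _; rewrite -EFinM exprD.
have dl := @lp_depends (k, 1%N) (m - k) n.-1.
rewrite (@Ex_indep _ _ lawmu _ (fun x => x.2 == 0%N) (lp_box (k, 1%N) (m - k) n.-1)).
- rewrite Ex_hsum // (Ex_lp p01 z1 _ lawmu (sites_uniq m n)) // => x hx.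
  split; last exact: bdry_law_box hx.
  by apply: sites_box hx => /=; rewrite ?subnKC ?add1n ?prednK.
- move=> e1 e2 h; congr ((z ^+ _)%:E); apply: eq_bigr => j _; exact: h.
- by move=> e1 e2 h; congr ((z ^+ _)%:E); apply: dl.
- by move=> [i j] /= /eqP->; rewrite /lp_box /= andbF.
- by move=> e1; rewrite lee_fin.
- by move=> e1; rewrite lee_fin.
Qed.

(** The exact formula [Ex_burke] is bounded by the sum over all the exit points. *)
Lemma mgf_lower m n : (0 < m)%N -> (0 < n)%N ->
  (bern_mgf z ^+ m)%:E <=
  \sum_(1 <= k < m.+1) (bern_mgf z ^+ k * geo_mgf z^-1 ^+ n)%:E * mgf p z (m - k) n.-1 +
  \sum_(1 <= l < n.+1) (geo_mgf z^-1 ^+ (n - l))%:E * mgf p z m (n - l).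
Proof.
move=> m0 n0; have zV : (0 <= z^-1)%R by rewrite invr_ge0 ltW.
rewrite -(@Ex_burke _ _ _ p0 pv m n z (fun=> 0%N) (ltW z0)).
pose A k e := (z^-1 ^+ vsum e n)%:E *
   (z ^+ (hsum e k + lp e (k, 1%N) (m - k) n.-1))%:E.
pose B l e := (z^-1 ^+ (\sum_(l.+1 <= j < l.+1 + (n - l)) e (0, j))%N)%:E *
   (z ^+ lp e (0%N, l) m (n - l))%:E.
have A0 k e : 0 <= A k e by rewrite /A mule_ge0 ?lee_fin.
have B0 k e : 0 <= B k e by rewrite /B mule_ge0 ?lee_fin.
apply: (@le_trans _ _ (Ex mu (sites m n) (fun e =>
    \sum_(1 <= k < m.+1) A k e + \sum_(1 <= l < n.+1) B l e) (fun=> 0%N))).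
  apply: Ex_le => // [e|e]; first by rewrite lee_fin.
  rewrite exp_gb; have [[k km h]|[l ln h]] := gb_exit e m0 n0.
    apply: le_trans (leeDl _ _); last by apply: sume_ge0.
    rewrite (bigD1_seq k) /= ?mem_index_iota ?iota_uniq //.
    apply: le_trans (leeDl _ _); last by apply: sume_ge0.
    by rewrite /A -EFinM lee_fin mulrC ler_wpM2l // ler_weXn2l.
  apply: le_trans (leeDr _ _); last by apply: sume_ge0.
  rewrite (bigD1_seq l) /= ?mem_index_iota ?iota_uniq //.
  apply: le_trans (leeDl _ _); last by apply: sume_ge0.
  have -> : vsum e n = (vsum e l + \sum_(l.+1 <= j < l.+1 + (n - l)) e (0, j))%N.
    rewrite /vsum addSn subnKC; last by case/andP: ln.
    by rewrite -big_cat_nat //= ltnS; case/andP: ln.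
  rewrite /B -!EFinM lee_fin exprD mulrA [leRHS]mulrC ler_wpM2r //.
  by rewrite exprVn ler_pdivrMr ?exprn_gt0 // -exprD ler_weXn2l // addnC.
rewrite ExD => [|//|e|e]; try by apply: sume_ge0.
rewrite !Ex_sum //; apply: leeD; rewrite big_nat_cond [leRHS]big_nat_cond;
  apply: lee_sum => k; rewrite andbT => /andP[k1 km].
  rewrite mulrC EFinM -muleA -(Ex_hor_term (fun=> 0%N)) //.
  have -> : (geo_mgf z^-1 ^+ n)%:E =
      Ex mu (sites m n) (fun e => (z^-1 ^+ vsum e n)%:E) (fun=> 0%N).
    by apply/esym; apply: (@Ex_vsum m n 0 n) => //; exact: geo_ratio_inv.
  rewrite (@Ex_indep _ _ lawmu _ (fun x => x.1 == 0%N) (fun x => x.1 != 0%N)) //.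
  - move=> e1 e2 h; congr ((z^-1 ^+ _)%:E); apply: eq_bigr => j _; exact: h.
  - move=> e1 e2 h; congr ((z ^+ (_ + _))%:E).
      by apply: eq_big_nat => -[|j] // _; exact: h.
    by apply: lp_depends => -[[|i] j]; rewrite /lp_box //= => _; exact: h.
  - by move=> x /= ->.
  - by move=> e'; rewrite lee_fin.
  - by move=> e'; rewrite lee_fin.
rewrite [X in X <= _](@Ex_vsum_lp m n (0%N, k) m (n - k) k (n - k) _ _ zV
  geo_ratio_inv) //= ?subnKC //.
Qed.

Lemma G_hor_bounds m n e : (0 < m)%N -> (0 < n)%N ->
  (forall k, (0 < k <= m)%N ->
     (bern_mgf z ^+ k)%:E * mgf p z (m - k) n.-1 <=
     Ex mu (sites m n) (fun e => (z ^+ G_hor e (m, n))%:E) e) /\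
  Ex mu (sites m n) (fun e => (z ^+ G_hor e (m, n))%:E) e <=
  \sum_(1 <= k < m.+1) (bern_mgf z ^+ k)%:E * mgf p z (m - k) n.-1.
Proof.
move=> m0 n0; split=> [k km|].
  rewrite -(Ex_hor_term e) //; last by case/andP: km.
  apply: Ex_le => // [e'|e']; rewrite lee_fin // ler_weXn2l //.
  rewrite G_horE //.
  exact: (@leq_bigmax_nat1 m k (fun k => hsum e' k + lp e' (k, 1) (m - k) n.-1)%N).
have -> : \sum_(1 <= k < m.+1) (bern_mgf z ^+ k)%:E * mgf p z (m - k) n.-1 =
    Ex mu (sites m n) (fun e => \sum_(1 <= k < m.+1)
      (z ^+ (hsum e k + lp e (k, 1%N) (m - k) n.-1))%:E) e.
  rewrite Ex_sum => [|//|k e']; last by rewrite lee_fin.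
  by apply: eq_big_nat => k /andP[_ km]; rewrite Ex_hor_term.
apply: Ex_le => // e'; rewrite ?lee_fin // G_horE //.
have [k km ->] := bigmax_nat_attained
  (fun k => hsum e' k + lp e' (k, 1) (m - k) n.-1)%N m0.
rewrite (bigD1_seq k) /= ?mem_index_iota ?iota_uniq //.
by apply: leeDl; apply: sume_ge0 => i _; rewrite lee_fin.
Qed.

Lemma Ex_ver_term m n w m' n' l e : ((1 - geom_param p v) * z < 1)%R ->
  (l <= n)%N -> (0 < w.2)%N -> (w.1 + m' <= m)%N -> (w.2 + n' <= n)%N ->
  Ex mu (sites m n) (fun e => (z ^+ (vsum e l + lp e w m' n'))%:E) e =
  (geo_mgf z ^+ l)%:E * mgf p z m' n'.
Proof.
move=> hz ln w2 wm wn; rewrite -(@Ex_vsum_lp m n w m' n' 0 l z e) ?ltW //.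
by apply: Ex_ext => e' _; rewrite -EFinM exprD.
Qed.

(** The two bounds use different boxes, as in [gb_exit]: the lower one starts at the
    site where the vertical axis has been left, the upper one on the axis. *)
Lemma G_ver_bounds m n e : ((1 - geom_param p v) * z < 1)%R ->
  (0 < m)%N -> (0 < n)%N ->
  (forall l, (0 < l <= n)%N ->
     (geo_mgf z ^+ l)%:E * mgf p z m.-1 (n - l) <=
     Ex mu (sites m n) (fun e => (z ^+ G_ver e (m, n))%:E) e) /\
  Ex mu (sites m n) (fun e => (z ^+ G_ver e (m, n))%:E) e <=
  \sum_(1 <= l < n.+1) (geo_mgf z ^+ l)%:E * mgf p z m (n - l).
Proof.
move=> hz m0 n0; split=> [l /andP[l0 ln]|].
  rewrite -(@Ex_ver_term m n (1, l)%N m.-1 (n - l) l e) //=; last first.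
  - by rewrite subnKC.
  - by rewrite add1n prednK.
  apply: Ex_le => // [e'|e']; rewrite lee_fin // ler_weXn2l // G_verE //.
  apply: leq_trans (@leq_bigmax_nat1 n l (fun l =>
    vsum e' l + e' (1, l) + lp e' (1, l) m.-1 (n - l))%N _); last by rewrite l0.
  by rewrite leq_add2r leq_addr.
have -> : \sum_(1 <= l < n.+1) (geo_mgf z ^+ l)%:E * mgf p z m (n - l) =
    Ex mu (sites m n) (fun e => \sum_(1 <= l < n.+1)
      (z ^+ (vsum e l + lp e (0%N, l) m (n - l)))%:E) e.
  rewrite Ex_sum => [|//|l e']; last by rewrite lee_fin.
  apply: eq_big_nat => l /andP[l0 ln].
  by rewrite (@Ex_ver_term m n (0%N, l)) //= subnKC.
apply: Ex_le => // e'; rewrite ?lee_fin // G_verE //.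
have [l /andP[l0 ln] ->] := bigmax_nat_attained
  (fun l => vsum e' l + e' (1, l) + lp e' (1, l) m.-1 (n - l))%N n0.
rewrite (bigD1_seq l) /= ?mem_index_iota ?iota_uniq ?l0 //.
apply: le_trans (leeDl _ _); last by apply: sume_ge0 => i _; rewrite lee_fin.
rewrite lee_fin ler_weXn2l // -addnA leq_add2l.
apply: leq_trans (_ : lp e' (0, l)%N 1 0 + lp e' (0 + 1, l + 0)%N m.-1 (n - l) <= _)%N.
  by rewrite lpS0 !add0n !addn0 leq_add2r.
by apply: leq_trans (lp_cat _ _ _ _ _ _) _; rewrite add1n prednK.
Qed.

Lemma geo_law_mgf_infty : (1 <= (1 - geom_param p v) * z)%R ->
  \sum_(0 <= a <oo) (geo (geom_param p v) a)%:E * (z ^+ a)%:E = +oo.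
Proof.
move=> hz; apply/eqyP => A A0.
have [k hk] : exists k, (A <= k%:R * geom_param p v)%R.
  exists (Num.truncn (A / geom_param p v)).+1.
  by rewrite -ler_pdivrMr // ltW // truncnS_gt.
have t0 a : 0 <= (geo (geom_param p v) a)%:E * (z ^+ a)%:E.
  by rewrite mule_ge0 // lee_fin ?geo_ge0.
apply: le_trans (nneseries_lim_ge k _) => //.
apply: (@le_trans _ _ (\sum_(0 <= i < k) (geom_param p v)%:E)).
  by rewrite sumEFin lee_fin sumr_const_nat subn0 -mulr_natl.
apply: lee_sum => a _; rewrite -EFinM lee_fin /geo -mulrA -exprMn.
by rewrite ler_peMr ?exprn_ege1 // ltW.
Qed.

Lemma G_ver_infty m n e : (1 <= (1 - geom_param p v) * z)%R ->
  (0 < m)%N -> (0 < n)%N ->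
  Ex mu (sites m n) (fun e => (z ^+ G_ver e (m, n))%:E) e = +oo.
Proof.
move=> hz m0 n0; apply/eqP; rewrite -leye_eq -(geo_law_mgf_infty hz).
rewrite -(Ex_site lawmu (J := sites m n) (v := (0, 1)%N)
  (h := fun a => (z ^+ a)%:E) e) ?sites_uniq //; last by rewrite mem_sites /= n0.
apply: Ex_le => // [e'|e']; rewrite lee_fin // ler_weXn2l // G_verE //.
apply: leq_trans (@leq_bigmax_nat1 n 1 (fun l =>
    vsum e' l + e' (1, l) + lp e' (1, l) m.-1 (n - l))%N _); last by rewrite n0.
by rewrite /vsum big_nat1 -addnA leq_addr.
Qed.

End Exponents.

(** * Rates of growth *)

Section Rates.
Variable R : realType.

Lemma ln_le_linear (e : R) : 0 < e ->
  exists K, forall x : R, 0 < x -> ln x <= e * x + K.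
Proof.
move=> e0; exists (- ln e) => x x0.
have ex0 : 0 < e * x by rewrite mulr_gt0.
have := le_ln1Dx (x := e * x - 1); rewrite addrCA subrr addr0 lnM // => h.
have : -1 < e * x - 1 by lra.
by move/h; lra.
Qed.

Lemma cvg_rate (X : nat -> R) (a : R) :
  (forall e, 0 < e -> exists K N0, forall N, (N0 <= N)%N ->
     (a - e) * N%:R - K <= X N <= (a + e) * N%:R + K) ->
  (fun N => N%:R^-1 * X N) @ \oo --> a.
Proof.
move=> h; apply/cvgrPdist_le => e e0.
have e20 : 0 < e / 2 by lra.
have [K [N0 hK]] := h _ e20.
exists (maxn N0 (Num.truncn (`|K| / (e / 2))).+1) => // N /=.
rewrite geq_max => /andP[/hK/andP[lo hi] N1].
have Npos : 0 < N%:R :> R by rewrite ltr0n; case: N N1 {lo hi}.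
have KN : `|K| <= (e / 2) * N%:R.
  rewrite mulrC -ler_pdivrMr //; apply/ltW; apply: lt_le_trans (truncnS_gt _) _.
  by rewrite ler_nat.
have := ler_norm K; have := ler_norm (- K); rewrite normrN => nK1 nK2.
rewrite distrC ler_norml; apply/andP; split.
  rewrite lerBrDr mulrC ler_pdivlMr //; nra.
rewrite lerBlDr mulrC ler_pdivrMr //; nra.
Qed.

Lemma le_of_rate (a b : R) :
  (forall e, 0 < e -> exists K, forall N : nat, (a - e) * N%:R - K <= b * N%:R) ->
  a <= b.
Proof.
move=> h; rewrite leNgt; apply/negP => ab.
have e0 : 0 < (a - b) / 2 by lra.
have [K hK] := h _ e0.
have := truncnS_gt (`|K| / ((a - b) / 2)); have := hK (Num.truncn (`|K| / ((a - b) / 2))).+1.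
move: (Num.truncn _).+1 => N; rewrite ltr_pdivrMr // => h1 h2; have := ler_norm K; nra.
Qed.

End Rates.

(** What is used of the logarithms of the moment generating functions of boxes. *)
Record growth (R : realType) (l : nat -> nat -> R) : Prop := Growth {
  growth_ge0 : forall m n, 0 <= l m n;
  growth_le : forall m n m' n', (m <= m')%N -> (n <= n')%N -> l m n <= l m' n';
  growth_super : forall m1 n1 m2 n2,
    l m1 n1 + l m2 n2 <= l (m1 + m2)%N (n1 + n2)%N;
  growth_lin : exists C, forall m n, l m n <= C * (m%:R + n%:R) }.

Lemma superadditive_iter (R : realType) (l : nat -> nat -> R) k m n :
  (forall m n, 0 <= l m n) ->
  (forall m1 n1 m2 n2, l m1 n1 + l m2 n2 <= l (m1 + m2)%N (n1 + n2)%N) ->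
  k%:R * l m n <= l (k * m)%N (k * n)%N.
Proof.
move=> l_ge0 l_super; elim: k => [|k IH]; first by rewrite mul0r.
by rewrite -natr1 mulrDl mul1r !mulSn addrC; apply: le_trans (l_super _ _ _ _); rewrite lerD2l.
Qed.

(** Applied to the [N]-fold dilation of a box, the bound loses its constant in the
    limit. *)
Lemma superadditive_drop_cst (R : realType) (l : nat -> nat -> R) (a b K : R) :
  (forall m n, 0 <= l m n) ->
  (forall m1 n1 m2 n2, l m1 n1 + l m2 n2 <= l (m1 + m2)%N (n1 + n2)%N) ->
  (forall m n, l m n <= a * m%:R + b * n%:R + K) ->
  forall m n, l m n <= a * m%:R + b * n%:R.
Proof.
move=> l_ge0 l_super h m n; apply: le_of_rate => e e0; exists K => N.
have := h (N * m)%N (N * n)%N; have := superadditive_iter N m n l_ge0 l_super.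
rewrite !natrM; have : 0 <= e * N%:R by rewrite mulr_ge0 // ltW.
lra.
Qed.

Section Scaling.
Variables (R : realType) (l : nat -> nat -> R).
Hypothesis gl : growth l.

Let l_ge0 := growth_ge0 gl.
Let l_le := growth_le gl.
Let l_super := growth_super gl.

Lemma growth00 : l 0 0 = 0.
Proof.
by apply/eqP; rewrite eq_le l_ge0 andbT; have := l_super 0 0 0 0; rewrite addn0; lra.
Qed.

Definition lx (s t x : R) : R := l (Num.truncn (x * s)) (Num.truncn (x * t)).

(** Letting [x] range over all positive reals, not only the integers, makes
    homogeneity immediate. *)
Definition rate (s t : R) : R := sup [set lx s t x / x | x in [set x : R | 0 < x]].

Implicit Types s t x : R.

Lemma natr_truncn_le x : 0 <= x -> (Num.truncn x)%:R <= x.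
Proof. by rewrite truncn_le. Qed.

Lemma rate_has_sup s t : 0 <= s -> 0 <= t ->
  has_sup [set lx s t x / x | x in [set x : R | 0 < x]].
Proof.
have [C l_lin] := growth_lin gl.
have C0 : 0 <= C by have := le_trans (l_ge0 _ _) (l_lin 1 0); rewrite addr0 mulr1.
move=> s0 t0; split; first by exists (lx s t 1 / 1); exists 1 => //=.
exists (C * (s + t)) => _ [x /= x0 <-]; rewrite ler_pdivrMr //.
apply: le_trans (l_lin _ _) _; rewrite -mulrA ler_wpM2l // mulrDl.
by apply: lerD; rewrite mulrC natr_truncn_le // mulr_ge0 // ltW.
Qed.

Lemma lx_le_rate s t x : 0 <= s -> 0 <= t -> 0 <= x -> lx s t x <= x * rate s t.
Proof.
move=> s0 t0; rewrite le_eqVlt => /predU1P[<-|x0].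
  by rewrite /lx !mul0r truncn0 growth00.
rewrite mulrC -ler_pdivrMr //; apply: (sup_upper_bound (rate_has_sup s0 t0)).
by exists x.
Qed.

Lemma rate_le s t (B : R) : 0 <= s -> 0 <= t ->
  (forall x, 0 < x -> lx s t x <= B * x) -> rate s t <= B.
Proof.
move=> s0 t0 h; apply: ge_sup; first by have [] := rate_has_sup s0 t0.
by move=> _ [x /= x0 <-]; rewrite ler_pdivrMr // h.
Qed.

Lemma lx_super s t x y : 0 <= s -> 0 <= t -> 0 <= x -> 0 <= y ->
  lx s t x + lx s t y <= lx s t (x + y).
Proof.
move=> s0 t0 x0 y0; apply: le_trans (l_super _ _ _ _) _.
have tr (r : R) : 0 <= r ->
    (Num.truncn (x * r)%R + Num.truncn (y * r)%R <= Num.truncn ((x + y) * r)%R)%N.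
  move=> r0; rewrite truncn_ge_nat ?mulr_ge0 ?addr_ge0 // natrD mulrDl.
  by rewrite lerD // natr_truncn_le // mulr_ge0.
by apply: l_le; apply: tr.
Qed.

Lemma lx_le s t s' t' x x' : 0 <= s -> 0 <= t -> 0 <= x ->
  s <= s' -> t <= t' -> x <= x' -> lx s t x <= lx s' t' x'.
Proof.
by move=> s0 t0 x0 ss tt xx; apply: l_le; apply: le_truncn; rewrite ler_pM.
Qed.

(** Fekete's argument: [y] is a multiple of a nearly optimal [x], up to a bounded
    error. *)
Lemma lx_lower s t e : 0 <= s -> 0 <= t -> 0 < e ->
  exists K, forall y, 0 <= y -> (rate s t - e) * y - K <= lx s t y.
Proof.
move=> s0 t0 e0; have [_ [x /= x0 <-] hx] := sup_adherent e0 (rate_has_sup s0 t0).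
exists (lx s t x) => y y0; set k := Num.truncn (y / x).
have lxk : k%:R * lx s t x <= lx s t (k%:R * x).
  elim: (k) => [|j IH]; first by rewrite !mul0r /lx mul0r !l_ge0.
  rewrite -natr1 !mulrDl !mul1r; apply: le_trans (lx_super _ _ _ _) => //.
    by rewrite lerD2r.
    by rewrite mulr_ge0 // ltW.
  exact: ltW.
have kx : k%:R * x <= y by rewrite -ler_pdivlMr // natr_truncn_le // divr_ge0 // ltW.
have lek : lx s t (k%:R * x) <= lx s t y.
  by apply: lx_le => //; rewrite mulr_ge0 // ltW.
have yk : y / x - 1 <= k%:R.
  have := truncnS_gt (y / x); rewrite -/k -natr1; lra.
have L0 : 0 <= lx s t x by apply: l_ge0.
have : (y / x - 1) * lx s t x <= k%:R * lx s t x by rewrite ler_wpM2r.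
have : (rate s t - e) * y <= lx s t x / x * y by rewrite ler_wpM2r // ltW.
rewrite (_ : lx s t x / x * y = y / x * lx s t x); last by ring.
by lra.
Qed.

Lemma rate_ge0 s t : 0 <= s -> 0 <= t -> 0 <= rate s t.
Proof.
by move=> s0 t0; have := lx_le_rate s0 t0 ler01; rewrite mul1r => h; apply: le_trans h; apply: l_ge0.
Qed.

Lemma rate_mono s t s' t' : 0 <= s -> 0 <= t -> s <= s' -> t <= t' ->
  rate s t <= rate s' t'.
Proof.
move=> s0 t0 ss tt; apply: rate_le => // x x0; rewrite mulrC.
apply: le_trans (lx_le_rate _ _ (ltW x0)); last 2 first.
- exact: le_trans ss.
- exact: le_trans tt.
by apply: lx_le => //; exact: ltW.
Qed.

Lemma rate_super s t s' t' : 0 <= s -> 0 <= t -> 0 <= s' -> 0 <= t' ->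
  rate s t + rate s' t' <= rate (s + s') (t + t').
Proof.
move=> s0 t0 s0' t0'; apply: le_of_rate => e e0.
have e20 : 0 < e / 2 by lra.
have [K hK] := lx_lower s0 t0 e20; have [K' hK'] := lx_lower s0' t0' e20.
exists (K + K') => N; have N0 := ler0n R N.
have := hK _ N0; have := hK' _ N0.
have := lx_le_rate (addr_ge0 s0 s0') (addr_ge0 t0 t0') N0.
have : lx s t N%:R + lx s' t' N%:R <= lx (s + s') (t + t') N%:R.
  apply: le_trans (l_super _ _ _ _) _.
  have tr (r r' : R) : 0 <= r -> 0 <= r' ->
      (Num.truncn (N%:R * r)%R + Num.truncn (N%:R * r')%R
        <= Num.truncn (N%:R * (r + r'))%R)%N.
    move=> r0 r0'; rewrite truncn_ge_nat ?mulr_ge0 ?addr_ge0 // natrD mulrDr.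
    by apply: lerD; apply: natr_truncn_le; rewrite mulr_ge0.
  by apply: l_le; apply: tr.
lra.
Qed.

Lemma rate_hom (a : R) s t : 0 <= a -> 0 <= s -> 0 <= t ->
  rate (a * s) (a * t) = a * rate s t.
Proof.
rewrite le_eqVlt => /predU1P[<-|].
  move=> s0 t0; rewrite !mul0r; apply/eqP; rewrite eq_le rate_ge0 // andbT.
  by apply: rate_le => // x x0; rewrite /lx mulr0 truncn0 growth00 mul0r.
have half b s' t' : 0 < b -> 0 <= s' -> 0 <= t' ->
    rate (b * s') (b * t') <= b * rate s' t'.
  move=> b0 s0 t0; apply: rate_le; rewrite ?mulr_ge0 ?(ltW b0) // => x x0.
  have -> : lx (b * s') (b * t') x = lx s' t' (b * x).
    by rewrite /lx !mulrA (mulrC x b).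
  rewrite mulrAC; apply: lx_le_rate => //; by rewrite mulr_ge0 ?ltW.
move=> a0 s0 t0; apply/eqP; rewrite eq_le half //=.
have := half a^-1 (a * s) (a * t); rewrite !mulKf ?gt_eqF // invr_gt0 => /(_ a0).
rewrite !mulr_ge0 ?(ltW a0) // => /(_ isT isT).
by rewrite ler_pdivlMl.
Qed.

Lemma l_le_rate m n : l m n <= rate m%:R n%:R.
Proof.
have := lx_le_rate (ler0n R m) (ler0n R n) ler01.
by rewrite /lx !mul1r !natrK.
Qed.

Lemma rate_linear (a b : R) s t : 0 <= a -> 0 <= b -> 0 <= s -> 0 <= t ->
  (forall m n, l m n <= a * m%:R + b * n%:R) -> rate s t <= a * s + b * t.
Proof.
move=> a0 b0 s0 t0 h; apply: rate_le => // x x0; apply: le_trans (h _ _) _.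
rewrite mulrDl -!mulrA !(mulrC _ x); apply: lerD; rewrite ler_wpM2l //;
  by rewrite natr_truncn_le // mulr_ge0 // ltW.
Qed.

Lemma cvg_rate_lx s t : 0 <= s -> 0 <= t ->
  (fun N : nat => N%:R^-1 * lx s t N%:R) @ \oo --> rate s t.
Proof.
move=> s0 t0; apply: cvg_rate => e e0; have [K hK] := lx_lower s0 t0 e0.
exists `|K|, 0 => N _; have N0 := ler0n R N.
have := hK _ N0; have := lx_le_rate s0 t0 N0; have := ler_norm K.
have : 0 <= e * N%:R by rewrite mulr_ge0 // ltW.
have := normr_ge0 K.
lra.
Qed.

End Scaling.

(** * The critical direction *)

Section Critical.
Variables (R : realType) (l : nat -> nat -> R).
Hypothesis gl : growth l.

Lemma two_sided_slopes (f g : R -> R) (u a b e : R) (P : R -> Prop) :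
  is_derive u 1 f a -> is_derive u 1 g b -> 0 < e ->
  (\forall v \near u, P v) ->
  exists2 h, 0 < h & forall k, k = h \/ k = - h -> P (u + k) /\
    `|(f (u + k) - f u) / k - a| <= e /\ `|(g (u + k) - g u) / k - b| <= e.
Proof.
move=> [df fa] [dg gb] e0 nP.
have slope (f0 : R -> R) a0 : derivable f0 u 1 -> 'D_1 f0 u = a0 ->
    \forall k \near (0 : R)^', `|(f0 (u + k) - f0 u) / k - a0| <= e.
  move=> d0 <-.
  have /cvgrPdist_le/(_ e e0) : (fun k => (f0 (u + k) - f0 u) / k) @ (0 : R)^' --> 'D_1 f0 u.
    rewrite (_ : (fun k => _) = (fun k => k^-1 *: ((f0 \o shift u) (k *: 1) - f0 u))) //.
    by apply/funext => k /=; rewrite [k *: 1]mulr1 [LHS]mulrC (addrC u).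
  by apply: filterS => k; rewrite distrC.
have /= := slope _ _ df fa; have := slope _ _ dg gb; move: nP.
rewrite !near_withinE => -[e1 /= e10 h1] [e2 /= e20 h2] [e3 /= e30 h3].
pose h := Num.min e1 (Num.min e2 e3) / 2.
have m0 : 0 < Num.min e1 (Num.min e2 e3) by rewrite !lt_min e10 e20.
have h0 : 0 < h by rewrite divr_gt0.
exists h => // k hk.
have kh : `|k| = h by case: hk => ->; rewrite ?normrN gtr0_norm.
have k0 : k != 0 by rewrite -normr_gt0 kh.
have hlt : h < Num.min e1 (Num.min e2 e3) by rewrite ltr_pdivrMr // ltr_pMr // ltr1n.
move: hlt; rewrite !lt_min => /and3P[l1 l2 l3].
by split; [apply: h1|split; [apply: h3|apply: h2]] => //=;
  rewrite ?sub0r ?opprD ?addNKr ?normrN ?kh // addrA subrr sub0r normrN kh.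
Qed.

Lemma lt_sum_nat (n : nat) (f : nat -> R) (B : R) : (0 < n)%N ->
  (forall k, (1 <= k < n.+1)%N -> f k < B) ->
  \sum_(1 <= k < n.+1) f k < n%:R * B.
Proof.
case: n => // n _; elim: n => [|n IH] h.
  by rewrite big_nat1 mul1r h.
rewrite big_nat_recr //= -natr1 mulrDl mul1r ltrD ?h ?leqnn //.
by apply: IH => k /andP[k1 k2]; rewrite h // k1 ltnW.
Qed.

(** One of the [2 * N] terms is at least their average; it belongs to a site on one of
    the two far sides of a square of side [N]. *)
Lemma exit_attained (c g : R) (N : nat) : g <= 0 -> (0 < N)%N ->
  expR (N%:R * c) <=
    \sum_(1 <= k < N.+1) expR (k%:R * c + N%:R * g + l (N - k) N.-1) +
    \sum_(1 <= k < N.+1) expR ((N - k)%:R * g + l N (N - k)) ->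
  exists i j, [/\ (i <= N)%N, (j <= N)%N, i = N \/ j = N &
    i%:R * c - j%:R * g - ln (2 * N%:R) <= l i j].
Proof.
move=> g0 N0 h; apply: contrapT => hn.
have NR : 0 < N%:R :> R by rewrite ltr0n.
have lt_l i j : (i <= N)%N -> (j <= N)%N -> i = N \/ j = N ->
    l i j < i%:R * c - j%:R * g - ln (2 * N%:R).
  by move=> iN jN e; rewrite ltNge; apply/negP => hl; apply: hn; exists i, j.
pose B := expR (N%:R * c - ln (2 * N%:R)).
have : expR (N%:R * c) < N%:R * B + N%:R * B.
  apply: le_lt_trans h _; apply: ltrD; apply: lt_sum_nat => // k /andP[k1 kN];
    rewrite ltr_expR.
    have := lt_l (N - k)%N N (leq_subr _ _) (leqnn _) (or_intror erefl).
    have := growth_le gl (m := N - k) (n := N.-1) (m' := N - k) (n' := N) (leqnn _) (leq_pred _).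
    by rewrite natrB // mulrBl; lra.
  have := lt_l N (N - k)%N (leqnn _) (leq_subr _ _) (or_introl erefl).
  by lra.
rewrite /B expRD expRN lnK ?posrE ?mulr_gt0 // -mulrDl (_ : _ + _ = 2 * N%:R); last by ring.
by rewrite mulrCA divff ?mulr1 ?ltxx // mulf_neq0 ?gt_eqF.
Qed.

Variables (c g : R -> R) (u c' g' : R).
Hypothesis dc : is_derive u 1 c c'.
Hypothesis dg : is_derive u 1 g g'.
Hypothesis c'0 : 0 < c'.
Hypothesis g'0 : 0 < g'.
Hypothesis c0 : 0 <= c u.
Hypothesis g0 : g u <= 0.
Hypothesis l_upper : \forall v \near u,
  forall i j, l i j <= i%:R * c v - j%:R * g v.
Hypothesis l_exit : forall N, (0 < N)%N ->
  expR (N%:R * c u) <=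
    \sum_(1 <= k < N.+1) expR (k%:R * c u + N%:R * g u + l (N - k) N.-1) +
    \sum_(1 <= k < N.+1) expR ((N - k)%:R * g u + l N (N - k)).

Let l_upper_u i j : l i j <= i%:R * c u - j%:R * g u.
Proof. exact: (nbhs_singleton l_upper). Qed.

Lemma natr_le_log_false (K : R) :
  (forall N, (0 < N)%N -> N%:R <= K * ln (2 * N%:R)) -> False.
Proof.
move=> h; pose K1 := `|K| + 1.
have K0 : 0 < K1 by rewrite ltr_wpDl.
have e0 : 0 < (4 * K1)^-1 by rewrite invr_gt0 mulr_gt0.
have [A hA] := ln_le_linear e0.
set N := (Num.truncn (2 * K1 * `|A|)).+1.
have N1 : 1 <= N%:R :> R by rewrite ler1n.
have hN := h N isT.
have NA : 2 * K1 * `|A| < N%:R by apply: truncnS_gt.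
have : ln (2 * N%:R) <= (4 * K1)^-1 * (2 * N%:R) + A by apply: hA; rewrite mulr_gt0 //; lra.
have l0 : 0 <= ln (2 * N%:R : R) by apply: ln_ge0; lra.
have KK : K * ln (2 * N%:R) <= K1 * ln (2 * N%:R).
  by rewrite ler_wpM2r // /K1; have := ler_norm K; lra.
move=> h1; have : K1 * ln (2 * N%:R) <= K1 * ((4 * K1)^-1 * (2 * N%:R) + A).
  by rewrite ler_pM2l.
have -> : K1 * ((4 * K1)^-1 * (2 * N%:R) + A) = N%:R / 2 + K1 * A.
  by field; rewrite gt_eqF.
have : K1 * A <= K1 * `|A| by rewrite ler_pM2l // ler_norm.
lra.
Qed.

(** For every side [N] some site [(i, j)] of the far sides of the square nearly attains
    the bound of the parameter [u] ([exit_attained]). Comparing with the bounds of the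
    parameters [u + h] and [u - h] confines [j / i] to a narrow cone around
    [c' / g']; by monotonicity and homogeneity the rate at the slope [c' / g'] is
    then almost as large as the bound. *)
Lemma rate_critical : rate l 1 (c' / g') = c u - c' / g' * g u.
Proof.
set k := c' / g'; have k0 : 0 < k by rewrite divr_gt0.
set phi := rate l 1 k; set D := c u - k * g u.
have Dge : phi <= D.
  have := @rate_linear _ _ gl (c u) (- g u) 1 k c0; rewrite oppr_ge0 g0 ler01 (ltW k0).
  move=> /(_ isT isT isT); rewrite mulr1 (_ : _ + _ = D); last by rewrite /D; ring.
  by apply=> i j; rewrite mulrC mulNr (mulrC (g u)); exact: l_upper_u.
have phi0 : 0 <= phi by apply: rate_ge0 => //; exact: ltW.
apply/eqP; rewrite eq_le Dge /= leNgt; apply/negP => phiD.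
(* [1 + tau] is the relative tolerance on the slopes of the curve near [u] *)
have [tau tau0 [tau1 htau]] :
    exists2 tau, 0 < tau & tau <= 1 /\ 3 * tau * phi <= (D - phi) / 2.
  have DD : 0 < D - phi by lra.
  exists (Num.min 1 ((D - phi) / (6 * (phi + 1)))).
    by rewrite lt_min ltr01 divr_gt0 // mulr_gt0 //; lra.
  split; first by rewrite ge_min lexx.
  have p1 : 0 < phi + 1 by lra.
  set M := (D - phi) / (6 * (phi + 1)).
  have MM : 6 * M * (phi + 1) = D - phi by rewrite /M; field; rewrite gt_eqF.
  have M0 : 0 < M by rewrite divr_gt0 // mulr_gt0.
  have mM : Num.min 1 M <= M by rewrite ge_min lexx orbT.
  have : Num.min 1 M * phi <= M * phi by rewrite ler_wpM2r.
  lra.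
pose th := 1 + tau.
pose e := tau / (2 + tau).
have t2 : 0 < 2 + tau by lra.
have e0 : 0 < e by rewrite divr_gt0.
have the : 1 + e = th * (1 - e) by rewrite /th /e; field; rewrite gt_eqF.
have e1 : e < 1 by rewrite ltr_pdivrMr; lra.
pose m := Num.min c' g'.
have m0 : 0 < m by rewrite lt_min c'0.
have em0 : 0 < e * m by rewrite mulr_gt0.
have [h h0 hh] := two_sided_slopes dc dg em0 l_upper.
have [up [cp gp]] := hh h (or_introl erefl).
have [um [cm gm]] := hh (- h) (or_intror erefl).
have mc : e * m <= e * c' by rewrite ler_wpM2l ?(ltW e0) // ge_min lexx.
have mg : e * m <= e * g' by rewrite ler_wpM2l ?(ltW e0) // ge_min lexx orbT.
move: cp gp cm gm; rewrite !ler_norml.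
set cp := (c (u + h) - c u) / h; set gp := (g (u + h) - g u) / h.
set cm := (c (u - h) - c u) / - h; set gm := (g (u - h) - g u) / - h.
move=> /andP[_ cp1] /andP[gp1 _] /andP[cm1 _] /andP[_ gm1].
have cpE : c (u + h) = c u + cp * h.
  by rewrite /cp divfK ?gt_eqF // [RHS]addrC subrK.
have gpE : g (u + h) = g u + gp * h.
  by rewrite /gp divfK ?gt_eqF // [RHS]addrC subrK.
have cmE : c (u - h) = c u - cm * h.
  by rewrite /cm invrN mulrN mulNr opprK divfK ?gt_eqF // [RHS]addrC subrK.
have gmE : g (u - h) = g u - gm * h.
  by rewrite /gm invrN mulrN mulNr opprK divfK ?gt_eqF // [RHS]addrC subrK.
pose A := (g' * (1 - e) * h)^-1; pose B := (g' * (1 + e) * h)^-1.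
have gh1 : 0 < g' * (1 - e) * h by rewrite !mulr_gt0 // subr_gt0.
have gh2 : 0 < g' * (1 + e) * h by rewrite !mulr_gt0 // addr_gt0.
have A0 : 0 < A by rewrite invr_gt0.
have B0 : 0 < B by rewrite invr_gt0.
have th1 : 1 < th by rewrite /th; lra.
have th0 : 0 < th by lra.
have th2 : th <= 2 by rewrite /th; lra.
have DD : 0 <= D - phi by lra.
pose C1 := A * phi / k - g u * B + 1.
have C10 : 0 < C1.
  have : 0 <= A * phi / k by rewrite !mulr_ge0 ?invr_ge0 // ltW.
  have : g u * B <= 0 by rewrite mulr_le0_ge0 // ltW.
  by rewrite /C1; lra.
pose del := (D - phi) / 4.
have del0 : 0 < del by rewrite /del; lra.
apply: (@natr_le_log_false (C1 / del * (1 + k * th) + k * (A / k))) => N N0.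
have [i [j [iN jN ijN hl]]] := exit_attained g0 N0 (l_exit N0).
set rho := ln (2 * N%:R) in hl *.
have N1 : 1 <= N%:R :> R by rewrite ler1n.
have rho0 : 0 < rho by apply: ln_gt0; lra.
have i0 := ler0n R i; have j0 := ler0n R j.
have Nij : N%:R <= i%:R + j%:R :> R.
  by case: ijN => ->; rewrite ?lerDl ?lerDr.
move: (i%:R) (j%:R) i0 j0 Nij (up i j) (um i j) hl (l_le_rate gl i j) => x y x0 y0 Nij.
rewrite cpE gpE cmE gmE => upb umb hl hr.
have hc1 : x * (cp * h) <= x * (c' * (1 + e) * h).
  by rewrite ler_wpM2l // ler_pM2r //; lra.
have hg1 : y * (g' * (1 - e) * h) <= y * (gp * h).
  by rewrite ler_wpM2l // ler_pM2r //; lra.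
have hc2 : x * (c' * (1 - e) * h) <= x * (cm * h).
  by rewrite ler_wpM2l // ler_pM2r //; lra.
have hg2 : y * (gm * h) <= y * (g' * (1 + e) * h).
  by rewrite ler_wpM2l // ler_pM2r //; lra.
have e1' : 1 - e != 0 by rewrite subr_eq0 gt_eqF.
have e1p : 1 + e != 0 by rewrite gt_eqF // addr_gt0.
have [hN0 g'N0 c'N0 thN0] : [/\ h != 0, g' != 0, c' != 0 & th != 0].
  by rewrite !gt_eqF.
(* [yle] compares with the parameter [u + h], [yge] with [u - h] *)
have yle : y <= k * (th * x + A / k * rho).
  have -> : k * (th * x + A / k * rho) = (x * (c' * (1 + e) * h) + rho) * A.
    by rewrite /A /k the; field; rewrite hN0 e1' g'N0 c'N0.
  by rewrite ler_pdivlMr //; lra.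
have yge : k * x / th - rho * B <= y.
  have -> : k * x / th - rho * B = (x * (c' * (1 - e) * h) - rho) * B.
    have -> : B = (g' * (th * (1 - e)) * h)^-1 by rewrite /B the.
    by rewrite /k; field; rewrite hN0 e1' g'N0 thN0.
  by rewrite ler_pdivrMr //; lra.
have Ak0 : 0 < A / k by rewrite divr_gt0.
have xle : x <= th * x + A / k * rho.
  have : 0 <= (th - 1) * x by rewrite mulr_ge0 // subr_ge0 ltW.
  have : 0 < A / k * rho by rewrite mulr_gt0.
  lra.
have hr2 : l i j <= (th * x + A / k * rho) * phi.
  have a0 : 0 < th * x + A / k * rho.
    by apply: ltr_wpDl; [apply: mulr_ge0 => //; exact: ltW|apply: mulr_gt0].
  rewrite -(rate_hom gl (ltW a0) ler01 (ltW k0)) mulr1 (mulrC _ k).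
  by apply: le_trans hr _; apply: rate_mono.
have hx : x * del <= C1 * rho.
  have h1 : - g u * (k * x / th - rho * B) <= - g u * y.
    by rewrite ler_wpM2l // oppr_ge0.
  have h2 : x * c u / th <= x * c u.
    by rewrite ler_pdivrMr // ler_peMr ?mulr_ge0 // ltW.
  have h3 : x * (D / th - th * phi) <= C1 * rho.
    have -> : C1 * rho = A / k * rho * phi - g u * (rho * B) + rho by rewrite /C1; ring.
    have -> : x * (D / th - th * phi) =
        x * c u / th - g u * (k * x / th) - th * x * phi by rewrite /D; ring.
    lra.
  apply: le_trans h3; rewrite ler_wpM2l //.
  have tt : th * th * phi <= (D + phi) / 2.
    have : tau * tau * phi <= tau * phi.
      by rewrite ler_wpM2r // ler_piMr // ltW.
    have -> : th * th * phi = phi + 2 * tau * phi + tau * tau * phi by rewrite /th; ring.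
    lra.
  have -> : D / th - th * phi = (D - th * th * phi) / th by field.
  rewrite ler_pdivlMr // /del.
  have : (D - phi) / 4 * th <= (D - phi) / 4 * 2.
    by rewrite ler_wpM2l // divr_ge0.
  lra.
have xN : x <= C1 / del * rho.
  by rewrite mulrAC ler_pdivlMr.
have -> : (C1 / del * (1 + k * th) + k * (A / k)) * rho =
    C1 / del * rho + k * (th * (C1 / del * rho) + A / k * rho) by ring.
have : k * (th * x + A / k * rho) <= k * (th * (C1 / del * rho) + A / k * rho).
  by rewrite ler_pM2l // lerD2r ler_pM2l.
lra.
Qed.
End Critical.

(** * Optimizing over the exit point *)

Section SiteOne.
Variable R : realType.

Definition coord1 (r : R) (N : nat) : nat := maxn 1 (Num.truncn (N%:R * r)).

Lemma coord1_le r N : 0 <= r -> (coord1 r N)%:R <= N%:R * r + 1.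
Proof.
move=> r0; have Nr : 0 <= N%:R * r by rewrite mulr_ge0.
have := natr_truncn_le Nr; rewrite /coord1.
by case: (leqP 1 (Num.truncn _)) => _; lra.
Qed.

Lemma coord1_ge r N : N%:R * r - 1 <= (coord1 r N)%:R.
Proof.
have h := truncnS_gt (N%:R * r); rewrite -natr1 in h.
have : (Num.truncn (N%:R * r))%:R <= (coord1 r N)%:R :> R by rewrite ler_nat leq_maxr.
lra.
Qed.

Lemma coord1_shift r : 0 <= r -> exists K0, forall K N, (K0 <= K)%N -> (K <= N)%N ->
  (Num.truncn ((N - K)%:R * r) < coord1 r N)%N.
Proof.
rewrite le_eqVlt => /predU1P[<-|r0].
  by exists 0 => K N _ _; rewrite mulr0 truncn0 leq_maxl.
exists (Num.truncn r^-1).+1 => K N K0 KN.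
apply: leq_trans (leq_maxr _ _); rewrite truncn_ge_nat ?(mulr_ge0 _ (ltW r0)) //.
have h0 : 0 <= (N - K)%:R * r by rewrite mulr_ge0 // ltW.
have := natr_truncn_le h0; rewrite -natr1 natrB // mulrBl.
have : 1 <= K%:R * r.
  by rewrite -ler_pdivrMr // div1r; apply/ltW/(lt_le_trans (truncnS_gt _)); rewrite ler_nat.
lra.
Qed.

Lemma coord1E r N : 1 <= N%:R * r -> coord1 r N = Num.truncn (N%:R * r).
Proof. by move=> h; rewrite /coord1 (maxn_idPr _) // truncn_gt0. Qed.

End SiteOne.

Section Exit.
Variables (R : realType) (l : nat -> nat -> R).
Hypothesis gl : growth l.
Variables c g k : R.
Hypotheses (c0 : 0 <= c) (g0 : 0 <= g) (k0 : 0 < k).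
Hypothesis l_upper : forall m n, l m n <= c * m%:R + g * n%:R.
Hypothesis rate_k : rate l 1 k = c + k * g.

Lemma rate_ray a : 0 <= a -> rate l a (a * k) = a * c + a * k * g.
Proof.
move=> a0; have := rate_hom gl a0 ler01 (ltW k0).
by rewrite mulr1 rate_k mulrDr mulrA.
Qed.

Lemma rate_upper s t : 0 <= s -> 0 <= t -> rate l s t <= c * s + g * t.
Proof. by move=> s0 t0; apply: rate_linear. Qed.

(** Above the critical ray, leaving the horizontal axis late does not pay: by
    concavity along the segment from [(a, T)] to the point of the ray at the same
    height, on which the linear upper bound is attained. *)
Lemma rate_concave a S T : 0 <= a <= S -> k * S <= T ->
  (S - a) * c + rate l a T <= rate l S T.
Proof.
move=> /andP[a0 aS] kST.
have S0 : 0 <= S := le_trans a0 aS.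
have T0 : 0 <= T by apply: le_trans kST; rewrite mulr_ge0 // ltW.
move: aS; rewrite le_eqVlt => /predU1P[<-|aS]; first by rewrite subrr mul0r add0r.
pose b := T / k; have bk : b * k = T by rewrite divfK ?gt_eqF.
have Sb : S <= b by rewrite ler_pdivlMr // mulrC.
have ab : 0 < b - a by rewrite subr_gt0; apply: lt_le_trans Sb.
pose la := (b - S) / (b - a).
have la0 : 0 <= la by rewrite divr_ge0 ?(ltW ab) // subr_ge0.
have la1 : la <= 1 by rewrite ler_pdivrMr // mul1r lerD2l lerN2 ltW.
have la1' : 0 <= 1 - la by rewrite subr_ge0.
have laE : la * a + (1 - la) * b = S by rewrite /la; field; rewrite gt_eqF.
have b0 : 0 <= b := le_trans S0 Sb.
have := rate_super gl (mulr_ge0 la0 a0) (mulr_ge0 la0 T0)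
  (mulr_ge0 la1' b0) (mulr_ge0 la1' T0).
rewrite laE (_ : la * T + (1 - la) * T = T); last by ring.
rewrite !(rate_hom gl) //.
have := rate_ray b0; rewrite bk => ->.
have h := rate_upper a0 T0.
have : (1 - la) * (rate l a T) <= (1 - la) * (c * a + g * T).
  by rewrite ler_wpM2l // subr_ge0.
rewrite -laE; lra.
Qed.

Variables s t : R.
Hypotheses (s0 : 0 <= s) (t0 : 0 <= t).
Variable X : nat -> R.
Let m := coord1 s.
Let n := coord1 t.
Hypothesis X_lower : forall N j, (0 < N)%N -> (0 < j <= m N)%N ->
  j%:R * c + l (m N - j) (n N).-1 <= X N.
Hypothesis X_upper : forall N, (0 < N)%N ->
  expR (X N) <= \sum_(1 <= j < (m N).+1) expR (j%:R * c + l (m N - j) (n N)).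

Lemma sum_expR_le (x M : R) i (f : nat -> R) : (0 < i)%N ->
  (forall j, (0 < j <= i)%N -> f j <= M) ->
  expR x <= \sum_(1 <= j < i.+1) expR (f j) -> x <= ln i%:R + M.
Proof.
move=> i0 fM h; have iR : 0 < i%:R :> R by rewrite ltr0n.
rewrite -ler_expR expRD lnK ?posrE //; apply: le_trans h _.
rewrite big_nat_cond; apply: (@le_trans _ _ (\sum_(1 <= j < i.+1) expR M)).
  rewrite [leRHS]big_nat_cond; apply: ler_sum => j; rewrite andbT => hj.
  by rewrite ler_expR fM.
by rewrite sumr_const_nat subn1 mulr_natl.
Qed.

Lemma ln_coord1_le e : 0 < e -> exists K, forall N, ln ((m N)%:R : R) <= e * N%:R + K.
Proof.
move=> e0; have s1 : 0 < s + 1 by rewrite ltr_wpDl.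
have [K hK] := ln_le_linear (divr_gt0 e0 s1).
exists (e / (s + 1) + K) => N.
have m0 : 0 < (m N)%:R :> R by rewrite ltr0n leq_maxl.
apply: le_trans (hK _ m0) _; rewrite addrA lerD2r.
apply: (@le_trans _ _ (e / (s + 1) * (N%:R * s + 1))).
  by rewrite ler_wpM2l ?coord1_le // divr_ge0 // ltW.
rewrite mulrDr mulr1 lerD2r -mulrA ler_wpM2l ?(ltW e0) //.
by rewrite ler_pdivrMl // mulrC ler_wpM2r // lerDl.
Qed.

(** The lower bounds come from one exit point: the one that leaves a box along the
    critical ray if that is possible, the first one otherwise. The upper bounds
    hold for each exit point, their number being subexponential. *)
Lemma cvg_exit :
  (fun N => N%:R^-1 * X N) @ \oo -->
  (if t < k * s then s * c + t * g else rate l s t).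
Proof.
have [Ks hKs] := coord1_shift s0; have [Kt hKt] := coord1_shift t0.
pose K0 := maxn Ks Kt.
have low b N : 0 <= b <= s -> (0 < N)%N -> (K0 <= N)%N ->
    ((m N)%:R - N%:R * b) * c + lx l b t (N - K0)%:R <= X N.
  move=> /andP[b0 bs] N0 KN.
  have bN : (Num.truncn ((N - K0)%:R * b) < m N)%N.
    apply: leq_ltn_trans (hKs K0 N (leq_maxl _ _) KN).
    by apply: le_truncn; rewrite ler_wpM2l.
  have := X_lower (j := m N - Num.truncn ((N - K0)%:R * b)) N0.
  rewrite subn_gt0 bN leq_subr subKn ?(ltnW bN) // => /(_ isT).
  have : lx l b t (N - K0)%:R <= l (Num.truncn ((N - K0)%:R * b)) (n N).-1.
    apply: (growth_le gl) => //; rewrite -ltnS prednK ?leq_maxl //.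
    exact: (hKt K0 N (leq_maxr _ _) KN).
  have : (Num.truncn ((N - K0)%:R * b))%:R <= N%:R * b.
    apply: le_trans (natr_truncn_le _) _; first by rewrite mulr_ge0.
    by rewrite ler_wpM2r // ler_nat leq_subr.
  move: (Num.truncn _) bN => i0 bN hi.
  have : i0%:R * c <= N%:R * b * c by rewrite ler_wpM2r.
  rewrite (natrB _ (ltnW bN)); lra.
have low2 b e : 0 <= b <= s -> 0 < e -> exists K, forall N, (0 < N)%N -> (K0 <= N)%N ->
    ((s - b) * c + rate l b t - e) * N%:R - K <= X N.
  move=> bs e0; have b0 : 0 <= b by case/andP: bs.
  have [K hK] := lx_lower gl b0 t0 e0.
  exists (c + K + rate l b t * K0%:R) => N N0 KN.
  apply: le_trans (low b N bs N0 KN).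
  have := hK _ (ler0n R (N - K0)); rewrite natrB // => h.
  have : (N%:R * s - 1) * c <= (m N)%:R * c by rewrite ler_wpM2r // coord1_ge.
  have : 0 <= e * K0%:R by rewrite mulr_ge0 // ltW.
  lra.
apply: cvg_rate => e e0.
have [KL hKL] := ln_coord1_le e0.
case: ifPn => [tks|]; last rewrite -leNgt => kst.
  pose b := t / k.
  have b0 : 0 <= b by rewrite divr_ge0 // ltW.
  have bs : b <= s by rewrite ler_pdivrMr // mulrC ltW.
  have bk : b * k = t by rewrite divfK ?gt_eqF.
  have rb : rate l b t = b * c + t * g by rewrite -{1}bk rate_ray // bk.
  have bs2 : 0 <= b <= s by rewrite b0.
  have [K hK] := low2 b e bs2 e0; rewrite rb in hK.
  exists (`|K| + `|KL| + c + g), K0.+1 => N KN.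
  have N0 : (0 < N)%N by apply: leq_trans KN.
  have := hK N N0 (ltnW KN); have := hKL N.
  have up : X N <= ln ((m N)%:R : R) + ((m N)%:R * c + (n N)%:R * g).
    apply: sum_expR_le (X_upper N0); first exact: leq_maxl.
    move=> j /andP[j0 jm]; have := l_upper (m N - j) (n N).
    by rewrite natrB //; lra.
  have : (m N)%:R * c <= (N%:R * s + 1) * c by rewrite ler_wpM2r // coord1_le.
  have : (n N)%:R * g <= (N%:R * t + 1) * g by rewrite ler_wpM2r // coord1_le.
  have := ler_norm K; have := ler_norm KL; have := normr_ge0 K; have := normr_ge0 KL.
  have c0' := c0; have g0' := g0.
  move=> h1 h2 h3 h4 h5 h6 h7 h8; apply/andP; split; lra.
have bs2 : 0 <= s <= s by rewrite s0 lexx.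
have [K hK] := low2 s e bs2 e0; rewrite subrr mul0r add0r in hK.
have [s00|spos] := eqVneq s 0.
  exists (`|K| + c + l 0 1), K0.+1 => N KN.
  have N0 : (0 < N)%N by apply: leq_trans KN.
  have := hK N N0 (ltnW KN).
  have m1 : m N = 1%N by rewrite /m /coord1 s00 mulr0 truncn0.
  have := X_upper N0; rewrite m1 big_nat1 ler_expR subnn mul1r => hX.
  have hl : l 0 (n N) <= l 0 1 + N%:R * rate l s t.
    have := lx_le_rate gl s0 t0 (ler0n R N); rewrite /lx s00 mulr0 truncn0.
    have := growth_ge0 gl 0 1; have := growth_ge0 gl 0 (Num.truncn (N%:R * t)).
    by rewrite /n /coord1; case: (leqP 1 (Num.truncn _)) => _; lra.
  have : 0 <= e * N%:R by rewrite mulr_ge0 // ltW.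
  have := ler_norm K; have := normr_ge0 K; have := growth_ge0 gl 0 1.
  have c0' := c0.
  move=> h1 h2 h3 h4 h5; apply/andP; split; lra.
have s_gt0 : 0 < s by rewrite lt_def spos.
have t_gt0 : 0 < t by apply: lt_le_trans kst; rewrite mulr_gt0.
exists (`|K| + `|KL|), (maxn K0.+1 (maxn (Num.truncn s^-1).+1 (Num.truncn t^-1).+1)) => N.
rewrite !geq_max => /and3P[KN sN tN].
have N0 : (0 < N)%N by apply: leq_trans KN.
have big (r : R) : 0 < r -> (Num.truncn r^-1 < N)%N -> 1 <= N%:R * r.
  move=> r0 rN; rewrite -ler_pdivrMr // div1r.
  by apply/ltW/(lt_le_trans (truncnS_gt _)); rewrite ler_nat.
have := hK N N0 (ltnW KN); have := hKL N.
have mN : (m N)%:R <= N%:R * s by rewrite /m coord1E ?big // natr_truncn_le // mulr_ge0.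
have nN : (n N)%:R <= N%:R * t by rewrite /n coord1E ?big // natr_truncn_le // mulr_ge0.
have up : X N <= ln ((m N)%:R : R) + N%:R * rate l s t.
  apply: sum_expR_le (X_upper N0); first exact: leq_maxl.
  move=> j /andP[j0 jm]; rewrite -(rate_hom gl (ler0n R N) s0 t0).
  have jN : j%:R <= N%:R * s by apply: le_trans mN; rewrite ler_nat.
  have j0' := ler0n R j.
  have := @rate_concave (N%:R * s - j%:R) (N%:R * s) (N%:R * t).
  rewrite subr_ge0 jN lerBlDr lerDl j0' mulrCA ler_wpM2l // => /(_ isT isT).
  have := l_le_rate gl (m N - j) (n N).
  have : rate l (m N - j)%:R (n N)%:R <= rate l (N%:R * s - j%:R) (N%:R * t).
    by apply: rate_mono => //; rewrite natrB // lerD2r.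
  lra.
have : 0 <= e * N%:R by rewrite mulr_ge0 // ltW.
have := ler_norm K; have := ler_norm KL; have := normr_ge0 K; have := normr_ge0 KL.
move=> h1 h2 h3 h4 h5 h6 h7; apply/andP; split; lra.
Qed.

End Exit.

(** * Integrals over the given probability spaces *)

Section Link.
Context (d : measure_display) (T : measurableType d) (R : realType).
Variables (P : probability T R) (w : nat * nat -> {RV P >-> nat}).
Hypothesis indep : mutually_independent w.

Let env_at (x : T) : env := fun v => w v x.

Lemma measurable_site v (a : nat) : measurable (w v @^-1` [set a]).
Proof. by rewrite -[_ @^-1` _]setTI; exact: measurable_funPT. Qed.

Lemma measurable_env (J : seq (nat * nat)) (F : env -> Prop) : depends_on (fun x => x \in J) F ->
  measurable [set x | F (env_at x)].
Proof.
elim: J F => [|v J IH] F dF.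
  have FE x : F (env_at x) = F (fun=> 0%N) by apply: dF.
  have [F0|F0] := pselect (F (fun=> 0%N)).
    rewrite [X in measurable X](_ : _ = setT) //.
    by apply/seteqP; split=> x //= _; rewrite FE.
  rewrite [X in measurable X](_ : _ = set0) //.
  by apply/seteqP; split=> x //=; rewrite FE.
rewrite [X in measurable X](_ : _ = \bigcup_a (w v @^-1` [set a] `&`
    [set x | F (upd (env_at x) v a)])).
  apply: bigcup_measurable => a _; apply: measurableI; first exact: measurable_site.
  apply: (IH (fun e => F (upd e v a))) => e e' h; apply: dF => x.
  by rewrite /upd inE; case: eqVneq => //= _ /h.
have updE x : upd (env_at x) v (w v x) = env_at x.
  by apply/funext => y; rewrite /upd; case: eqP => // ->.
apply/seteqP; split=> [x /= Fx|x [a _ [/= <-]]]; last by rewrite updE.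
by exists (w v x) => //; split=> //=; rewrite updE.
Qed.

Variable mu : nat * nat -> nat -> R.
Hypothesis lawmu : is_law mu.

Let event (K : seq (nat * nat)) (e : env) : set T := \big[setI/setT]_(i <- K) (w i @^-1` [set e i]).

Let event_in K e x v : event K e x -> v \in K -> w v x = e v.
Proof. by rewrite /event -bigcap_seq => h vK; exact: (h v vK). Qed.

(** By conditioning on the sites one after the other: in the induction, the sites of
    [K] have been revealed and take the values of [e']. *)
Lemma integral_Ex (J : seq (nat * nat)) (f : env -> R) e : (forall e, 0 <= f e) -> uniq J ->
  (forall v, v \in J -> forall a, P (w v @^-1` [set a]) = (mu v a)%:E) ->
  depends_on (fun x => x \in J) f ->
  (\int[P]_x (f (fun v => w v x))%:E = Ex mu J (fun e => (f e)%:E) e)%E.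
Proof.
move=> f0 uJ lawJ df.
have mf : measurable_fun setT (EFin \o (fun x => f (env_at x))).
  apply/measurable_EFinP => _ B mB; rewrite setTI.
  apply: (@measurable_env J (fun e => B (f e))) => e1 e2 h.
  by rewrite (df e1 e2).
suff main K e' : uniq (K ++ J) -> depends_on (fun x => x \in K ++ J) f ->
    (\int[P]_(x in event K e') (f (env_at x))%:E =
     P (event K e') * Ex mu J (fun e => (f e)%:E) e')%E.
  have := main [::] e uJ df; rewrite /event big_nil => ->.
  by rewrite probability_setT mul1e.
elim: J K e' {uJ df} lawJ => [|v J IH] K e' lawJ uKJ df /=.
  rewrite cats0 in df.
  rewrite (eq_integral (cst (f e')%:E)); last first.
    move=> x; rewrite inE => hx; congr EFin; apply: df => i iK.
    exact: (event_in hx).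
  rewrite integral_cst; first by rewrite muleC.
  by apply: bigsetI_measurable => i _; exact: measurable_site.
have vK : v \notin K.
  by move: uKJ; rewrite cat_uniq /= negb_or => /and3P[_ /andP[]].
have eventE a : event (v :: K) (upd e' v a) = w v @^-1` [set a] `&` event K e'.
  rewrite /event big_cons upd_same; congr (_ `&` _).
  apply: eq_big_seq => i iK; rewrite upd_other //.
  by apply: contraNneq vK => <-.
have mevent K' e1 : measurable (event K' e1).
  by apply: bigsetI_measurable => i _; exact: measurable_site.
have lawK1 a : P (event (v :: K) (upd e' v a)) = (P (event K e') * (mu v a)%:E)%E.
  rewrite {1}/event indep; last first.
    by move: uKJ; rewrite cat_uniq /= vK => /and3P[].
  rewrite big_cons upd_same lawJ ?mem_head // muleC; congr (_ * _)%E.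
  rewrite /event indep; last by move: uKJ; rewrite cat_uniq => /andP[].
  apply: eq_big_seq => i iK; rewrite upd_other //.
  by apply: contraNneq vK => <-.
have -> : event K e' = \bigcup_a event (v :: K) (upd e' v a).
  apply/seteqP; split=> [x hx|x [a _]]; last by rewrite eventE => -[].
  by exists (w v x) => //; rewrite eventE.
rewrite ge0_integral_bigcup //=.
- have PE : (P (\bigcup_a event (v :: K) (upd e' v a)) = P (event K e')).
    congr (P _); apply/esym/seteqP; split=> [x hx|x [a _]]; last by rewrite eventE => -[].
    by exists (w v x) => //; rewrite eventE.
  rewrite PE -ge0_nneseriesZl //; last first.
    move=> a; rewrite mule_ge0 //.
      by rewrite -(lawJ v) ?mem_head.
    by apply: Ex_ge0 => // e1; rewrite lee_fin.
  apply: eq_eseriesr => a _; rewrite muleA -lawK1 IH //.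
  + by move=> i iJ; apply: lawJ; rewrite inE iJ orbT.
  + by rewrite -cat1s -catA uniq_catCA cat1s.
  + move=> e1 e2 h; apply: df => i; rewrite mem_cat inE => hi; apply: h.
    by rewrite inE mem_cat; move: hi; case: (i == v); rewrite ?orbT.
- exact: measurable_funS mf.
- by move=> x _; rewrite lee_fin.
- move=> a b _ _ [x []]; rewrite !eventE => -[/= <- _] [/= <- _] //.
Qed.

End Link.

Section Laws.
Context (d : measure_display) (T : measurableType d) (R : realType).
Variable P : probability T R.

Lemma Bernoulli_law_bern (X : {RV P >-> nat}) (q : R) : has_Bernoulli_law X q ->
  forall a, P (X @^-1` [set a]) = (bern q a)%:E.
Proof.
move=> hX; have h0 : P (X @^-1` [set 0%N]) = (1 - q)%:E := hX false.
have h1 : P (X @^-1` [set 1%N]) = q%:E := hX true.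
have mX a : measurable (X @^-1` [set a]).
  by rewrite -[_ @^-1` _]setTI; exact: measurable_funPT.
move=> [//|[//|a]] /=.
have PU : P ((X @^-1` [set 0%N] `|` X @^-1` [set 1%N]) `|` X @^-1` [set a.+2]) =
    (1%:E + P (X @^-1` [set a.+2]))%E.
  rewrite measureU //; last 2 first.
  - exact: measurableU.
  - by apply/seteqP; split=> // x /= [[] ->].
  rewrite measureU //; last by apply/seteqP; split=> // x /= [->].
  by rewrite [X in (X + _ + _)%E]h0 [X in (_ + X + _)%E]h1 -EFinD subrK.
have := probability_le1 P
  (measurableU _ _ (measurableU _ _ (mX 0%N) (mX 1%N)) (mX a.+2)).
rewrite PU; have : (0 <= P (X @^-1` [set a.+2]))%E by exact: measure_ge0.
case: (P _) => [r||] //=; rewrite ?lee_fin -?EFinD ?lee_fin => r0 r1.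
by congr EFin; lra.
Qed.

Variable w : nat * nat -> {RV P >-> nat}.
Hypothesis indep : mutually_independent w.
Variable mu : nat * nat -> nat -> R.
Hypothesis lawmu : is_law mu.

Lemma mgf_Ex (J : seq (nat * nat)) (G : env -> nat) (xi : R) e : uniq J ->
  (forall v, v \in J -> forall a, P (w v @^-1` [set a]) = (mu v a)%:E) ->
  depends_on (fun x => x \in J) G ->
  'M_P (fun x => (G (fun v => w v x))%:R) xi =
  Ex mu J (fun e => (expR xi ^+ G e)%:E) e.
Proof.
move=> uJ lawJ dG; rewrite /mmt_gen_fun unlock.
rewrite -(integral_Ex indep lawmu (f := fun e => expR xi ^+ G e)) //.
- by apply: eq_integral => x _ /=; rewrite expRM_natl.
- by move=> e1 e2 h; rewrite (dG e1 e2).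
Qed.

End Laws.

Lemma G_hor_depends m n : (0 < n)%N ->
  depends_on (fun x => x \in sites m n) (fun e => G_hor e (m, n)).
Proof.
move=> n0 e e' h; rewrite !G_horE //; apply: eq_big_nat => k /andP[k0 km].
congr (_ + _)%N.
  apply: eq_big_nat => -[|i] // /andP[_ ik]; apply: h.
  by rewrite mem_sites /= andbT; lia.
apply: lp_depends => x hx; apply: h; apply: sites_box hx => /=.
  by rewrite subnKC.
by rewrite add1n prednK.
Qed.

Lemma G_ver_depends m n : (0 < m)%N ->
  depends_on (fun x => x \in sites m n) (fun e => G_ver e (m, n)).
Proof.
move=> m0 e e' h; rewrite !G_verE //; apply: eq_big_nat => k /andP[k0 kn].
congr (_ + _ + _)%N.
- apply: eq_big_nat => -[|i] // /andP[_ ik]; apply: h.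
  by rewrite mem_sites /=; lia.
- by apply: h; rewrite mem_sites /= andbT; lia.
apply: lp_depends => x hx; apply: h; apply: sites_box hx => /=.
  by rewrite add1n prednK.
by rewrite subnKC.
Qed.

(** * Derivatives along the curve of parameters *)

Section Curve.
Variable R : realType.
Implicit Types p u v y z : R.

Lemma is_derive_ln_affine (a b u : R) : 0 < a + b * u ->
  is_derive u 1 (fun v => ln (a + b * v)) (b / (a + b * u)).
Proof.
move=> h.
have h1 : is_derive u 1 (fun v : R => a + b * v) b.
  have := is_deriveD (is_derive_cst a u 1) (is_deriveZ b (is_derive_id u (1 : R))).
  by rewrite add0r [b *: 1]mulr1.
have h2 := is_derive1_ln h.
have := @is_derive1_comp R (@ln R) (fun v => a + b * v) u _ _ h2 h1.
by rewrite mulrC.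
Qed.

Lemma is_derive_ln_bern_mgf (u y : R) : 0 < bern_mgf u y ->
  is_derive u 1 (fun v => ln (bern_mgf v y)) ((y - 1) / bern_mgf u y).
Proof.
have E v : bern_mgf v y = 1 + (y - 1) * v by rewrite /bern_mgf; ring.
by under eq_fun do rewrite E; rewrite !E; exact: is_derive_ln_affine.
Qed.

Lemma geo_ratio_lt (p v y : R) : 0 < p -> p < v < 1 ->
  ((1 - geom_param p v) * y < 1) = (p * (1 - v) * y < v * (1 - p)).
Proof.
move=> p0 pv; have /andP[pv1 v1] := pv.
have h : 0 < v * (1 - p).
  by rewrite mulr_gt0 ?subr_gt0 // ?(lt_trans p0 pv1) // (lt_trans pv1 v1).
by rewrite geom_paramC // mulrAC ltr_pdivrMr // mul1r.
Qed.

(** In this form the logarithm is a difference of logarithms of affine functions of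
    [v]. *)
Lemma geo_mgfE (p v y : R) : 0 < p -> p < v < 1 ->
  p * (1 - v) * y < v * (1 - p) ->
  geo_mgf p v y = (v - p) / (v * (1 - p) - p * (1 - v) * y).
Proof.
move=> p0 pv hy; have /andP[pv1 v1] := pv.
have h0 : v != 0 by rewrite gt_eqF // (lt_trans p0 pv1).
have h1 : 1 - p != 0 by rewrite gt_eqF // subr_gt0 (lt_trans pv1 v1).
have h2 : v * (1 - p) - p * (1 - v) * y != 0 by rewrite gt_eqF // subr_gt0.
rewrite /geo_mgf geom_paramC // /geom_param; field.
by rewrite h0 h1 h2.
Qed.

Lemma is_derive_ln_geo_mgf (p u y : R) : 0 < p -> p < u < 1 -> 0 < y ->
  p * (1 - u) * y < u * (1 - p) ->
  is_derive u 1 (fun v => ln (geo_mgf p v y))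
    (p * (1 - p) * (1 - y) / ((u - p) * (u * (1 - p) - p * (1 - u) * y))).
Proof.
move=> p0 /andP[pu u1] y0 hy.
have py0 : 0 < 1 - p + p * y.
  by rewrite addr_gt0 ?mulr_gt0 // subr_gt0 (lt_trans pu u1).
have ru : p * y / (1 - p + p * y) < u by rewrite ltr_pdivrMr //; lra.
have h1 : 0 < - p + 1 * u by lra.
have h2 : 0 < - (p * y) + (1 - p + p * y) * u by lra.
have := is_deriveB (is_derive_ln_affine h1) (is_derive_ln_affine h2).
have -> : 1 / (- p + 1 * u) - (1 - p + p * y) / (- (p * y) + (1 - p + p * y) * u) =
    p * (1 - p) * (1 - y) / ((u - p) * (u * (1 - p) - p * (1 - u) * y)).
  have h1' : u - p != 0 by rewrite gt_eqF; lra.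
  have h2' : u * (1 - p) - p * (1 - u) * y != 0 by rewrite gt_eqF; lra.
  by field; rewrite h1' h2'.
apply: near_eq_is_derive; near=> v.
have pv : p < v by near: v; exact: lt_nbhsr.
have v1 : v < 1 by near: v; exact: lt_nbhsl.
have hv : p * (1 - v) * y < v * (1 - p).
  have : p * y / (1 - p + p * y) < v by near: v; exact: lt_nbhsr.
  by rewrite ltr_pdivrMr //; lra.
rewrite geo_mgfE ?pv // ln_div ?posrE ?subr_gt0 //.
by congr (ln _ - ln _); ring.
Unshelve. all: by end_near. Qed.

End Curve.

(** * Logarithms of the moment generating functions *)

Lemma ln_pow (R : realType) (x : R) n : 0 < x -> ln (x ^+ n) = n%:R * ln x.
Proof. by move=> x0; rewrite lnXn // mulr_natl. Qed.

Section LogMgf.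
Variables (R : realType) (p z : R).
Hypothesis p01 : 0 < p < 1.
Hypothesis z1 : 1 < z.

Let p0 : 0 < p. Proof. by have /andP[] := p01. Qed.
Let z0 : 0 < z. Proof. exact: lt_trans z1. Qed.
Let z1' : 1 <= z. Proof. exact: ltW. Qed.

Definition log_mgf m n : R := ln (fine (mgf p z m n)).

Lemma bern_mgf_ge1 v : p < v < 1 -> 1 <= bern_mgf v z.
Proof.
move=> /andP[pv _]; have v0 : 0 < v := lt_trans p0 pv.
have := mulr_ge0 (ltW v0) (_ : 0 <= z - 1); rewrite subr_ge0 => /(_ z1').
rewrite /bern_mgf; lra.
Qed.

Lemma geo_mgf_le1 v : p < v < 1 -> geo_mgf p v z^-1 <= 1.
Proof.
move=> pv; have q0 := geom_param_gt0 p0 pv; have q1 := geom_paramC_gt0 p0 pv.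
have h := geo_ratio_inv p0 pv z1'.
rewrite /geo_mgf ler_pdivrMr ?subr_gt0 // mul1r.
have : (1 - geom_param p v) * z^-1 <= (1 - geom_param p v) * 1.
  by rewrite ler_pM2l // invf_le1.
lra.
Qed.

Lemma geo_mgf_inv_gt0 v : p < v < 1 -> 0 < geo_mgf p v z^-1.
Proof. by move=> pv; apply: geo_mgf_gt0 => //; apply: geo_ratio_inv. Qed.

Lemma mgf_fin m n : (mgf p z m n \is a fin_num)%E.
Proof.
have pv : p < (p + 1) / 2 < 1 by have /andP[? ?] := p01; apply/andP; split; lra.
have := mgf_upper p0 pv z1' m n; have := mgf_ge1 p01 z1' m n.
case: (mgf p z m n) => [r||] //= _.
by rewrite gt0_muley ?lte_fin ?exprn_gt0 // geo_mgf_inv_gt0.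
Qed.

Lemma mgf_gt0 m n : 0 < fine (mgf p z m n).
Proof.
have := mgf_ge1 p01 z1' m n; rewrite -(fineK (mgf_fin m n)) lee_fin.
exact: lt_le_trans.
Qed.

Lemma mgf_expR m n : mgf p z m n = (expR (log_mgf m n))%:E.
Proof. by rewrite /log_mgf lnK ?posrE ?mgf_gt0 // fineK ?mgf_fin. Qed.

Lemma log_mgf_ge0 m n : 0 <= log_mgf m n.
Proof.
apply: ln_ge0; have := mgf_ge1 p01 z1' m n.
by rewrite -(fineK (mgf_fin m n)) lee_fin.
Qed.

Lemma log_mgf_le m n m' n' : (m <= m')%N -> (n <= n')%N -> log_mgf m n <= log_mgf m' n'.
Proof.
move=> mm nn; have := mgf_le p01 z1' mm nn.
by rewrite !mgf_expR lee_fin ler_expR.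
Qed.

Lemma log_mgf_super m1 n1 m2 n2 :
  log_mgf m1 n1 + log_mgf m2 n2 <= log_mgf (m1 + m2) (n1 + n2).
Proof.
have := mgf_superM p01 z1' m1 n1 m2 n2.
by rewrite !mgf_expR -EFinM lee_fin -expRD ler_expR.
Qed.

Lemma log_mgf_upper v : p < v < 1 -> forall m n,
  log_mgf m n <= m%:R * ln (bern_mgf v z) - n%:R * ln (geo_mgf p v z^-1).
Proof.
move=> pv m n; have B0 : 0 < bern_mgf v z := lt_le_trans ltr01 (bern_mgf_ge1 pv).
have G0 := geo_mgf_inv_gt0 pv.
suff : log_mgf m n <= ln (bern_mgf v z) * m%:R + (- ln (geo_mgf p v z^-1)) * n%:R.
  by rewrite mulrC mulNr (mulrC (ln (geo_mgf _ _ _))).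
apply: (@superadditive_drop_cst _ _ _ _ (- ln (geo_mgf p v z^-1)) log_mgf_ge0 log_mgf_super).
move=> {}m {}n; have := mgf_upper p0 pv z1' m n.
rewrite mgf_expR -EFinM lee_fin => h.
have : ln (geo_mgf p v z^-1 ^+ n.+1 * expR (log_mgf m n)) <= ln (bern_mgf v z ^+ m).
  by rewrite ler_ln ?posrE ?mulr_gt0 ?exprn_gt0 ?expR_gt0.
rewrite lnM ?posrE ?exprn_gt0 ?expR_gt0 // !ln_pow // expRK -natr1.
lra.
Qed.

Lemma log_mgf_growth : growth log_mgf.
Proof.
split; [exact: log_mgf_ge0|exact: log_mgf_le|exact: log_mgf_super|].
have pv : p < (p + 1) / 2 < 1 by have /andP[? ?] := p01; apply/andP; split; lra.
move: ((p + 1) / 2) pv => v pv.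
exists (ln (bern_mgf v z) - ln (geo_mgf p v z^-1)) => m n.
apply: le_trans (log_mgf_upper pv m n) _.
have c0 : 0 <= ln (bern_mgf v z) by apply: ln_ge0; exact: bern_mgf_ge1.
have g0 : ln (geo_mgf p v z^-1) <= 0 by apply: ln_le0; exact: geo_mgf_le1.
have : 0 <= n%:R * ln (bern_mgf v z) by rewrite mulr_ge0.
have : m%:R * ln (geo_mgf p v z^-1) <= 0 by rewrite mulr_ge0_le0.
lra.
Qed.

Lemma log_mgf_exit v : p < v < 1 -> forall N, (0 < N)%N ->
  expR (N%:R * ln (bern_mgf v z)) <=
    \sum_(1 <= k < N.+1) expR (k%:R * ln (bern_mgf v z) +
       N%:R * ln (geo_mgf p v z^-1) + log_mgf (N - k) N.-1) +
    \sum_(1 <= k < N.+1) expR ((N - k)%:R * ln (geo_mgf p v z^-1) + log_mgf N (N - k)).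
Proof.
move=> pv N N0; have B0 : 0 < bern_mgf v z := lt_le_trans ltr01 (bern_mgf_ge1 pv).
have G0 := geo_mgf_inv_gt0 pv.
have := mgf_lower p0 pv z1' N0 N0.
under eq_bigr do rewrite mgf_expR -EFinM.
under [X in (_ <= _ + X)%E]eq_bigr do rewrite mgf_expR -EFinM.
have hB : expR (ln (bern_mgf v z)) = bern_mgf v z by rewrite lnK ?posrE.
have hG : expR (ln (geo_mgf p v z^-1)) = geo_mgf p v z^-1 by rewrite lnK ?posrE.
rewrite !sumEFin -EFinD lee_fin expRM_natl hB => h.
apply: le_trans h _; rewrite lerD //; apply: ler_sum => k _;
  by rewrite !expRD !expRM_natl ?hB hG.
Qed.

End LogMgf.

Section Slope.
Variable R : realType.

Lemma C_GeoE (q x : R) : 0 < q < 1 -> (1 - q) * expR x < 1 ->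
  C_Geo q x = (ln (q / (1 - (1 - q) * expR x)))%:E.
Proof.
move=> /andP[q0 q1] h; rewrite /C_Geo ifT //.
have q1' : 0 < 1 - q by rewrite subr_gt0.
by rewrite -ltr_expR expRN lnK ?posrE // -[ltRHS]mul1r ltr_pdivlMr // mulrC.
Qed.

Lemma C_Geo_mgf (p v x : R) : 0 < p -> p < v < 1 ->
  (1 - geom_param p v) * expR x < 1 ->
  C_Geo (geom_param p v) x = (ln (geo_mgf p v (expR x)))%:E.
Proof.
move=> p0 pv h; apply: C_GeoE => //.
by rewrite geom_param_gt0 // -subr_gt0 geom_paramC_gt0.
Qed.

Lemma critical_slopeE (p u x : R) : 0 < p -> p < u < 1 ->
  p * (1 - u) * expR (- x) < u * (1 - p) ->
  critical_slope p u x = ((expR x - 1) / bern_mgf u (expR x)) /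
    (p * (1 - p) * (1 - expR (- x)) /
     ((u - p) * (u * (1 - p) - p * (1 - u) * expR (- x)))).
Proof.
move=> p0 pu hu; have /andP[pu1 u1] := pu; rewrite /critical_slope.
have u0 : 0 < u := lt_trans p0 pu1.
have B0 : 0 < bern_mgf u (expR x).
  by rewrite addr_gt0 ?subr_gt0 // mulr_gt0 // expR_gt0.
have := is_derive_ln_bern_mgf B0; rewrite /bern_mgf => -[_ d1].
have [_ d2] := is_derive_ln_geo_mgf p0 pu (expR_gt0 (- x)) hu.
have py0 : 0 < 1 - p + p * expR (- x).
  by rewrite addr_gt0 ?mulr_gt0 ?expR_gt0 // subr_gt0 (lt_trans pu1 u1).
have ru : p * expR (- x) / (1 - p + p * expR (- x)) < u.
  by rewrite ltr_pdivrMr //; lra.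
rewrite !derive1E [X in X / _]d1; congr (_ / _); rewrite -d2.
apply: near_eq_derive; near=> v.
have pv : p < v < 1.
  apply/andP; split; near: v; [exact: lt_nbhsr|exact: lt_nbhsl].
rewrite C_Geo_mgf // geo_ratio_lt //.
have : p * expR (- x) / (1 - p + p * expR (- x)) < v by near: v; exact: lt_nbhsr.
by rewrite ltr_pdivrMr //; lra.
Unshelve. all: by end_near. Qed.

End Slope.

(** * The two limits *)

Lemma log_mgf_rate_cvg (d : measure_display) (T : measurableType d) (R : realType)
    (P : probability T R) (G : nat -> T -> nat) (xi a : R) (X : nat -> R) :
  (forall N, (0 < N)%N -> 'M_P (fun x => (G N x)%:R) xi = (expR (X N))%:E) ->
  (fun N => N%:R^-1 * X N) @ \oo --> a ->
  log_mgf_rate P G xi @ \oo --> a%:E.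
Proof.
move=> GX Xa; have E : \forall N \near \oo,
    log_mgf_rate P G xi N = (N%:R^-1 * X N)%:E.
  exists 1%N => // N /= N0.
  by rewrite /log_mgf_rate GX // lne_EFin ?expR_gt0 // expRK -EFinM.
apply: cvg_EFin.
  by apply: filterS E => N ->.
apply: cvg_trans Xa; apply: near_eq_cvg.
by apply: filterS E => N /= ->.
Qed.

Lemma mgf0 (d : measure_display) (T : measurableType d) (R : realType)
    (P : probability T R) (X : T -> R) : 'M_P X 0 = 1%E.
Proof.
rewrite /mmt_gen_fun unlock (eq_integral (cst 1%E)).
  by rewrite integral_cst // mul1e; exact: probability_setT.
by move=> x _ /=; rewrite mulr0 expR0.
Qed.

Lemma log_mgf_rate0 (d : measure_display) (T : measurableType d) (R : realType)
    (P : probability T R) (G : nat -> T -> nat) :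
  log_mgf_rate P G 0 @ \oo --> 0%E.
Proof.
rewrite (_ : log_mgf_rate P G 0 = cst 0%E); first exact: cvg_cst.
by apply/funext => N; rewrite /log_mgf_rate mgf0 lne1 mule0.
Qed.

Section Bulk.
Variables (R : realType) (p xi : R).
Hypothesis p01 : 0 < p < 1.
Hypothesis xi0 : 0 < xi.
Let z1 : 1 < expR xi. Proof. by rewrite expR_gt1. Qed.

Lemma bulk_rate_cvg (d : measure_display) (T : measurableType d)
    (P : probability T R) (w : nat * nat -> {RV P >-> nat}) (s t : R) :
  0 <= s -> 0 <= t -> bulk_env p w ->
  log_mgf_rate P (fun N x =>
    last_passage (fun v => w v x) (0, 0)%N (scaled_site s t N)) xi @ \oo -->
  (rate (log_mgf p (expR xi)) s t)%:E.
Proof.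
move=> s0 t0 [indep law].
apply: (@log_mgf_rate_cvg _ _ _ _ _ _ _ (fun N => lx (log_mgf p (expR xi)) s t N%:R)).
  move=> N N0; rewrite /lx -(mgf_expR p01 z1).
  set m := Num.truncn _; set n := Num.truncn _.
  rewrite (_ : (fun x => _) = fun x => (lp (fun v => w v x) (0, 0)%N m n)%:R).
    by apply: (mgf_Ex (G := fun e => lp e (0, 0)%N m n) indep (bern_is_law p01))
      => [|v _ a|e e' h]; [exact: sites_uniq|exact: Bernoulli_law_bern|];
      apply: lp_depends => x hx; apply: h; exact: sites_box hx.
  by apply/funext => x; congr (_%:R); exact: (last_passageE (fun v => w v x) (0, 0)%N m n).
exact: (@cvg_rate_lx _ _ (log_mgf_growth p01 z1) _ _ s0 t0).
Qed.

End Bulk.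

Section Boundary.
Variables (R : realType) (p u xi s t : R).
Hypothesis p01 : 0 < p < 1.
Hypothesis pu : p < u < 1.
Hypothesis xi0 : 0 < xi.
Hypotheses (s0 : 0 <= s) (t0 : 0 <= t).
Context (d : measure_display) (T : measurableType d) (P : probability T R).
Variable w : nat * nat -> {RV P >-> nat}.
Hypothesis hw : boundary_env p u w.

Let p0 : 0 < p. Proof. by have /andP[] := p01. Qed.
Let u0 : 0 < u. Proof. by have /andP[h _] := pu; exact: lt_trans p0 h. Qed.
Let z := expR xi.
Let z1 : 1 < z. Proof. by rewrite expR_gt1. Qed.
Let z0 : 0 < z. Proof. exact: expR_gt0. Qed.
Let zV : z^-1 = expR (- xi). Proof. by rewrite expRN. Qed.
Let zV1 : z^-1 < 1. Proof. by rewrite invf_lt1. Qed.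
Let mu := bdry_law p u.
Let l := log_mgf p z.
Let gl : growth l := log_mgf_growth p01 z1.

Lemma bdry_env_law m n v : v \in sites m n ->
  forall a, P (w v @^-1` [set a]) = (mu v a)%:E.
Proof.
case: hw => _ hb hr hc _; case: v => [[|i] [|j]].
- by rewrite mem_sites andbF.
- by move=> _ a; exact: hc.
- by move=> _ a; apply: Bernoulli_law_bern.
- by move=> _ a; apply: Bernoulli_law_bern.
Qed.

Let G_mgf (G : env -> nat -> nat -> nat) m n :
  depends_on (fun x => x \in sites m n) (fun e => G e m n) ->
  'M_P (fun x => (G (fun v => w v x) m n)%:R) xi =
  Ex mu (sites m n) (fun e => (z ^+ G e m n)%:E) (fun=> 0%N).
Proof.
case: hw => indep _ _ _ _ dG.
apply: (mgf_Ex indep (bdry_is_law p0 pu) xi (fun=> 0%N) (sites_uniq m n)) dG.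
exact: bdry_env_law.
Qed.

Lemma hor_critical :
  0 < critical_slope p u xi /\
  rate l 1 (critical_slope p u xi) =
    ln (bern_mgf u z) + critical_slope p u xi * - ln (geo_mgf p u z^-1).
Proof.
have hu : p * (1 - u) * expR (- xi) < u * (1 - p).
  by rewrite -geo_ratio_lt // -zV geo_ratio_inv // ltW.
have /andP[pu1 u1] := pu.
have B0 : 0 < bern_mgf u z := lt_le_trans ltr01 (bern_mgf_ge1 p01 z1 pu).
have dc := is_derive_ln_bern_mgf B0.
have dg := is_derive_ln_geo_mgf p0 pu (expR_gt0 (- xi)) hu.
rewrite (critical_slopeE p0 pu hu) -/z -zV; rewrite -zV in hu dg.
set c' := _ / _ in dc *; set g' := _ / _ in dg *.
have c'0 : 0 < c' by rewrite divr_gt0 // subr_gt0.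
have g'0 : 0 < g'.
  rewrite /g' divr_gt0 ?mulr_gt0 ?subr_gt0 //.
  exact: lt_trans u1.
split; first by rewrite divr_gt0.
rewrite mulrN; apply: (rate_critical gl dc dg c'0 g'0).
- by apply: ln_ge0; exact: (bern_mgf_ge1 p01 z1 pu).
- by apply: ln_le0; exact: (geo_mgf_le1 p01 z1 pu).
- apply: filterS2 (lt_nbhsr pu1) (lt_nbhsl u1) => v pv v1.
  by apply: (log_mgf_upper p01 z1); rewrite pv.
- exact: (log_mgf_exit p01 z1 pu).
Qed.

Lemma hor_cvg :
  log_mgf_rate P
     (fun N x => G_hor (fun v => w v x) (scaled_site1 s t N)) xi @ \oo -->
  (if t < critical_slope p u xi * s
   then s * ln (bern_mgf u z) + t * - ln (geo_mgf p u z^-1)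
   else rate l s t)%:E.
Proof.
pose H N := Ex mu (sites (coord1 s N) (coord1 t N))
  (fun e => (z ^+ G_hor e (coord1 s N, coord1 t N))%:E) (fun=> 0%N).
have c1 (r : R) N : (0 < coord1 r N)%N by exact: leq_maxl.
have B0 : 0 < bern_mgf u z := lt_le_trans ltr01 (bern_mgf_ge1 p01 z1 pu).
have hb N := G_hor_bounds p0 pu (ltW z1) (fun=> 0%N) (c1 s N) (c1 t N).
have FE := mgf_expR p01 z1.
have lowE N k : (0 < k <= coord1 s N)%N ->
    ((expR (k%:R * ln (bern_mgf u z) + l (coord1 s N - k) (coord1 t N).-1))%:E <= H N)%E.
  move=> hk; apply: le_trans ((hb N).1 _ hk).
  by rewrite FE -EFinM expRD expRM_natl lnK ?posrE.
have upE N : (H N <= (\sum_(1 <= k < (coord1 s N).+1)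
    expR (k%:R * ln (bern_mgf u z) + l (coord1 s N - k) (coord1 t N).-1))%:E)%E.
  apply: le_trans (hb N).2 _; rewrite -sumEFin; apply: lee_sum => k _.
  by rewrite FE -EFinM expRD expRM_natl lnK ?posrE.
have HE N : H N = (expR (ln (fine (H N))))%:E.
  have := lowE N 1%N (c1 s N); have := upE N; case: (H N) => [r||] //= _.
  rewrite lee_fin => h; rewrite lnK // posrE.
  by apply: lt_le_trans h; exact: expR_gt0.
apply: (@log_mgf_rate_cvg _ _ _ _ _ _ _ (fun N => ln (fine (H N)))).
  move=> N _; rewrite -HE.
  exact: (@G_mgf (fun e m n => G_hor e (m, n)) _ _ (G_hor_depends (c1 t N))).
have [k0 kr] := hor_critical.
apply: (cvg_exit gl _ _ k0 _ kr s0 t0).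
- by apply: ln_ge0; exact: (bern_mgf_ge1 p01 z1 pu).
- by rewrite oppr_ge0; apply: ln_le0; exact: (geo_mgf_le1 p01 z1 pu).
- move=> m n; apply: le_trans (log_mgf_upper p01 z1 pu m n) _.
  by rewrite mulrC mulNr (mulrC (ln (geo_mgf _ _ _))).
- by move=> N j N0 hj; have h := lowE N j hj; rewrite HE lee_fin ler_expR in h.
- move=> N N0; have h := upE N; rewrite HE lee_fin in h; apply: le_trans h _.
  apply: ler_sum => k _; rewrite ler_expR lerD2l; apply: (log_mgf_le p01 z1) => //.
  exact: leq_pred.
Qed.

(** The parametrization of the curve by the boundary with vertical exits is that
    of the boundary with horizontal exits, up to this change of parameter, which
    multiplies the odds [v / (1 - v)] by [exp (- xi)]. *)
Definition tilt v : R := v * z^-1 / (1 - v + v * z^-1).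

Lemma tilt_spec v : p < v < 1 -> p * (1 - v) * z < v * (1 - p) ->
  [/\ p < tilt v < 1, bern_mgf (tilt v) z = (bern_mgf v z^-1)^-1 &
     geo_mgf p (tilt v) z^-1 = (geo_mgf p v z)^-1].
Proof.
move=> /andP[pv v1] hv; have v0 : 0 < v := lt_trans p0 pv.
have p1 : 0 < 1 - p by have /andP[_] := p01; rewrite subr_gt0.
have v1' : 0 < 1 - v by rewrite subr_gt0.
pose D := (1 - v) * z + v.
have D0 : 0 < D by rewrite addr_gt0 // mulr_gt0.
have zn0 : z != 0 by rewrite gt_eqF.
have Dn0 : D != 0 by rewrite gt_eqF.
have D1 : 1 - v + v * z^-1 != 0 by rewrite gt_eqF // addr_gt0 // mulr_gt0 // invr_gt0.
have D1E : 1 - v + v * z^-1 = D / z by rewrite /D; field.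
have tE : tilt v = v / D by rewrite /tilt D1E; field; rewrite zn0 Dn0.
have pt : p < tilt v < 1.
  rewrite tE ltr_pdivlMr // ltr_pdivrMr // mul1r ltrDr mulr_gt0 // andbT.
  by rewrite /D; lra.
split=> //.
  by rewrite /bern_mgf D1E tE /D; field; rewrite zn0 Dn0.
have ht : p * (1 - tilt v) * z^-1 < tilt v * (1 - p).
  by rewrite -geo_ratio_lt // geo_ratio_inv // ltW.
rewrite geo_mgfE // geo_mgfE ?pv //.
have -> : tilt v - p = (v * (1 - p) - p * (1 - v) * z) / D.
  by rewrite tE /D; field.
have -> : tilt v * (1 - p) - p * (1 - tilt v) * z^-1 = (v - p) / D.
  by rewrite tE /D; field; rewrite zn0 Dn0.
rewrite invf_div; field; rewrite Dn0 !gt_eqF ?subr_gt0 //.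
Qed.

Lemma ver_condition :
  (xi < ln (u * (1 - p) / (p * (1 - u)))) = (p * (1 - u) * z < u * (1 - p)).
Proof.
have /andP[pu1 u1] := pu.
have h : 0 < p * (1 - u) by rewrite mulr_gt0 ?subr_gt0.
have h' : 0 < u * (1 - p) by rewrite mulr_gt0 ?subr_gt0 // (lt_trans pu1 u1).
by rewrite -ltr_expR lnK ?posrE ?divr_gt0 // ltr_pdivlMr // mulrC.
Qed.

Hypothesis hver : p * (1 - u) * z < u * (1 - p).

Lemma bern_mgf_inv_gt0 v : p < v < 1 -> 0 < bern_mgf v z^-1.
Proof.
move=> /andP[pv v1].
by rewrite addr_gt0 ?subr_gt0 // mulr_gt0 ?invr_gt0 // (lt_trans p0 pv).
Qed.

Lemma ver_curve v : p < v < 1 -> p * (1 - v) * z < v * (1 - p) ->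
  exists2 v', p < v' < 1 & ln (bern_mgf v' z) = - ln (bern_mgf v z^-1) /\
    ln (geo_mgf p v' z^-1) = - ln (geo_mgf p v z).
Proof.
move=> pv hv; have [pt hB hG] := tilt_spec pv hv.
exists (tilt v) => //; rewrite hB hG !lnV ?posrE ?bern_mgf_inv_gt0 //.
by apply: geo_mgf_gt0 => //; rewrite geo_ratio_lt.
Qed.

Lemma ver_critical :
  0 < critical_slope p u (- xi) /\
  rate l 1 (critical_slope p u (- xi)) =
    - ln (bern_mgf u z^-1) + critical_slope p u (- xi) * ln (geo_mgf p u z).
Proof.
have /andP[pu1 u1] := pu.
have p1 : p < 1 := lt_trans pu1 u1.
have hz : p * (1 - u) * expR (- - xi) < u * (1 - p) by rewrite opprK.
have dc := is_deriveN (is_derive_ln_bern_mgf (bern_mgf_inv_gt0 pu)).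
have dg := is_deriveN (is_derive_ln_geo_mgf p0 pu z0 hver).
rewrite (critical_slopeE p0 pu hz) opprK -/z -zV -divrNN.
set c' := - ((z^-1 - 1) / _) in dc *; set g' := - (p * _ * _ / _) in dg *.
have c'0 : 0 < c'.
  by rewrite /c' -mulNr opprB divr_gt0 ?subr_gt0 // bern_mgf_inv_gt0.
have g'0 : 0 < g'.
  by rewrite /g' -mulNr -mulrN opprB divr_gt0 ?mulr_gt0 ?subr_gt0.
split; first by rewrite divr_gt0.
have [v' pv' [hc hg]] := ver_curve pu hver.
have := @rate_critical _ _ gl (fun v => - ln (bern_mgf v z^-1))
  (fun v => - ln (geo_mgf p v z)) u c' g' dc dg c'0 g'0.
rewrite /= mulrN opprK; apply.
- by rewrite -hc; apply: ln_ge0; exact: (bern_mgf_ge1 p01 z1).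
- by rewrite -hg; apply: ln_le0; exact: (geo_mgf_le1 p01 z1).
- have py0 : 0 < 1 - p + p * z by rewrite addr_gt0 ?mulr_gt0 ?subr_gt0.
  have ru : p * z / (1 - p + p * z) < u by rewrite ltr_pdivrMr //; have := hver; lra.
  apply: filterS3 (lt_nbhsr pu1) (lt_nbhsl u1) (lt_nbhsr ru) => v pv v1.
  rewrite ltr_pdivrMr // => hv.
  have [||v2 pv2 [<- <-]] := @ver_curve v; rewrite ?pv //; first by lra.
  exact: (log_mgf_upper p01 z1).
- by rewrite -hc -hg; exact: (log_mgf_exit p01 z1).
Qed.

Lemma ver_cvg :
  log_mgf_rate P
     (fun N x => G_ver (fun v => w v x) (scaled_site1 s t N)) xi @ \oo -->
  (if critical_slope p u (- xi) * s < t
   then t * ln (geo_mgf p u z) + s * - ln (bern_mgf u z^-1)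
   else rate l s t)%:E.
Proof.
pose H N := Ex mu (sites (coord1 s N) (coord1 t N))
  (fun e => (z ^+ G_ver e (coord1 s N, coord1 t N))%:E) (fun=> 0%N).
have hz : (1 - geom_param p u) * z < 1 by rewrite geo_ratio_lt.
have c1 (r : R) N : (0 < coord1 r N)%N by exact: leq_maxl.
have G0 : 0 < geo_mgf p u z by apply: geo_mgf_gt0.
have hG : expR (ln (geo_mgf p u z)) = geo_mgf p u z by rewrite lnK ?posrE.
have hb N := G_ver_bounds p0 pu (ltW z1) (fun=> 0%N) hz (c1 s N) (c1 t N).
have FE := mgf_expR p01 z1.
have lowE N k : (0 < k <= coord1 t N)%N ->
    ((expR (k%:R * ln (geo_mgf p u z) + l (coord1 s N).-1 (coord1 t N - k)))%:E
      <= H N)%E.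
  move=> hk; apply: le_trans ((hb N).1 _ hk).
  by rewrite FE -EFinM expRD expRM_natl hG.
have upE N : (H N <= (\sum_(1 <= k < (coord1 t N).+1)
    expR (k%:R * ln (geo_mgf p u z) + l (coord1 s N) (coord1 t N - k)))%:E)%E.
  apply: le_trans (hb N).2 _; rewrite -sumEFin; apply: lee_sum => k _.
  by rewrite FE -EFinM expRD expRM_natl hG.
have HE N : H N = (expR (ln (fine (H N))))%:E.
  have := lowE N 1%N (c1 t N); have := upE N; case: (H N) => [r||] //= _.
  rewrite lee_fin => h; rewrite lnK // posrE.
  by apply: lt_le_trans h; exact: expR_gt0.
apply: (@log_mgf_rate_cvg _ _ _ _ _ _ _ (fun N => ln (fine (H N)))).
  move=> N _; rewrite -HE.
  exact: (@G_mgf (fun e m n => G_ver e (m, n)) _ _ (G_ver_depends (c1 s N))).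
have [k0 kr] := ver_critical; have [v' pv' [hc hg]] := ver_curve pu hver.
(* the roles of the two axes are exchanged *)
pose lT m n := l n m.
have glT : growth lT.
  split=> [m n|m n m' n' mm nn|m1 n1 m2 n2|].
  - exact: (growth_ge0 gl).
  - exact: (growth_le gl).
  - exact: (growth_super gl).
  - by have [C hC] := growth_lin gl; exists C => m n; rewrite addrC; exact: hC.
have kV : 0 < (critical_slope p u (- xi))^-1 by rewrite invr_gt0.
have -> : (critical_slope p u (- xi) * s < t) = (s < (critical_slope p u (- xi))^-1 * t).
  by rewrite ltr_pdivlMl.
apply: (@cvg_exit _ lT glT _ _ _ _ _ kV _ _ t s t0 s0).
- by rewrite -[ln _]opprK -hg oppr_ge0; apply: ln_le0; exact: (geo_mgf_le1 p01 z1).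
- by rewrite -hc; apply: ln_ge0; exact: (bern_mgf_ge1 p01 z1).
- move=> m n; apply: le_trans (log_mgf_upper p01 z1 pv' n m) _.
  by rewrite hc hg le_eqVlt; apply/orP; left; apply/eqP; ring.
- have := rate_hom gl (ltW kV) ler01 (ltW k0); rewrite kr mulr1 mulVf ?gt_eqF //.
  by move=> h; rewrite [LHS]h mulrDr mulKf ?gt_eqF // addrC.
- by move=> N j N0 hj; have h := lowE N j hj; rewrite HE lee_fin ler_expR in h.
- by move=> N N0; have h := upE N; rewrite HE lee_fin in h; apply: le_trans h _.
Qed.

End Boundary.

Lemma ver_infty (R : realType) (p u xi s t : R) (d : measure_display)
    (T : measurableType d) (P : probability T R)
    (w : nat * nat -> {RV P >-> nat}) :
  0 < p < 1 -> p < u < 1 -> 0 < xi -> boundary_env p u w ->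
  u * (1 - p) <= p * (1 - u) * expR xi ->
  log_mgf_rate P
     (fun N x => G_ver (fun v => w v x) (scaled_site1 s t N)) xi @ \oo --> +oo%E.
Proof.
move=> p01 pu xi0 hw h; have /andP[p0 _] := p01.
have c1 (r : R) N : (0 < coord1 r N)%N by exact: leq_maxl.
have z1 : 1 <= expR xi by rewrite ltW // expR_gt1.
have hz : 1 <= (1 - geom_param p u) * expR xi.
  by rewrite leNgt geo_ratio_lt // -leNgt.
have [indep _ _ _ _] := hw.
have GN N : 'M_P (fun x => (G_ver (fun v => w v x) (scaled_site1 s t N))%:R) xi = +oo%E.
  rewrite -(G_ver_infty p0 pu z1 (fun=> 0%N) hz (c1 s N) (c1 t N)).
  apply: (mgf_Ex (G := fun e => G_ver e _) indep (bdry_is_law p0 pu)).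
  - exact: sites_uniq.
  - exact: (bdry_env_law hw).
  - exact: (G_ver_depends (c1 s N)).
apply: cvg_near_cst; exists 1%N => // N /= N0.
by rewrite /log_mgf_rate GN /= gt0_muley // lte_fin invr_gt0 ltr0n.
Qed.

Unset Implicit Arguments.
Set Strict Implicit.
Set Printing Implicit Defensive.

Theorem theorem5p1 (R : realType) (p s t u xi : R)
    (hp : 0 < p < 1) (hs : 0 <= s) (ht : 0 <= t) (hu : p < u < 1)
    (hxi : 0 <= xi)
    (* the model with boundaries *)
    (d : measure_display) (T : measurableType d) (P : probability T R)
    (w : nat * nat -> {RV P >-> nat}) (hw : boundary_env p u w)
    (* the model without boundaries *)
    (d' : measure_display) (T' : measurableType d') (P' : probability T' R)
    (w' : nat * nat -> {RV P' >-> nat}) (hw' : bulk_env p w') :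
  (log_mgf_rate P
     (fun N x => G_hor (fun v => w v x) (scaled_site1 s t N)) xi @ \oo -->
     (if (t < critical_slope p u xi * s)%R
      then s%:E * (C_Ber u xi)%:E - t%:E * C_Geo (geom_param p u) (- xi)%R
      else Lambda w' s t xi)%E)
  /\
  (log_mgf_rate P
     (fun N x => G_ver (fun v => w v x) (scaled_site1 s t N)) xi @ \oo -->
     (if (xi < ln (u * (1 - p) / (p * (1 - u))))%R
      then if (critical_slope p u (- xi) * s < t)%R
           then t%:E * C_Geo (geom_param p u) xi - s%:E * (C_Ber u (- xi)%R)%:E
           else Lambda w' s t xi
      else +oo)%E).
Proof.
have /andP[p0 p1] := hp; have /andP[pu u1] := hu.
have q0 : 0 < geom_param p u by exact: geom_param_gt0.
have q1 : geom_param p u < 1 by rewrite -subr_gt0 geom_paramC_gt0.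
have u0 : 0 < u := lt_trans p0 pu.
move: hxi; rewrite le_eqVlt => /predU1P[xi0|xi0].
  (* [xi = 0]: the critical slope is [0 / 0], but all the branches vanish *)
  rewrite -xi0 oppr0; have CB : C_Ber u (0 : R) = 0.
    by rewrite /C_Ber expR0 mulr1 subrK ln1.
  have CG : C_Geo (geom_param p u) 0 = 0%E.
    rewrite C_GeoE ?q0 // expR0 mulr1 ?gtrBl //.
    by rewrite opprB addrCA subrr addr0 divff ?ln1 // gt_eqF.
  have L0 : Lambda w' s t 0 = 0%E.
    by apply/cvg_lim => //; exact: log_mgf_rate0.
  rewrite CB CG L0 !mule0 oppe0 adde0 !if_same ifT; last first.
    apply: ln_gt0; rewrite ltr_pdivlMr ?mulr_gt0 ?subr_gt0 // mul1r; lra.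
  by split; exact: log_mgf_rate0.
have LE := cvg_lim (@ereal_hausdorff R) (bulk_rate_cvg hp xi0 hs ht hw').
rewrite -/(Lambda w' s t xi) in LE.
have z1 : 1 < expR xi by rewrite expR_gt1.
split.
  have h := hor_cvg hp hu xi0 hs ht hw.
  rewrite C_Geo_mgf // ?expRN ?geo_ratio_inv // ?(ltW z1) // LE.
  move: h; case: ifP => _ //.
  by rewrite mulrN EFinD EFinN !EFinM.
rewrite ver_condition //; case: ifPn => hz; last first.
  have hz' : u * (1 - p) <= p * (1 - u) * expR xi by rewrite leNgt.
  exact: (@ver_infty _ _ _ _ s t _ _ _ _ hp hu xi0 hw hz').
have h := ver_cvg hp hu xi0 hs ht hw hz.
rewrite C_Geo_mgf ?geo_ratio_lt // LE.
move: h; case: ifP => _ //.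
by rewrite mulrN EFinD EFinN !EFinM /C_Ber expRN.
Qed.
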